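(* Let $\mathbf{k}=(k_1,\dots,k_l)\in\mathbb{N}^l$ be a Krein-Adler sequence, and let $Q^{\mathbf{k}}_n(x,y)$, $0\leqslant n\leqslant k_l+1$, be the polynomials such that $$E_{\mathbf{k}}(z,x,y)=E(z,x,y)\sum_{n=0}^{k_l+1} z^n Q^{\mathbf{k}}_n(x,y)\qquad\text{for all } |z|<1,\ x,y\in\mathbb{C}.$$ Denote $$\Omega(x,y):=\frac{1}{y-x}\Big(\frac{H_{\mathbf{k}}'(y)}{H_{\mathbf{k}}(y)}-\frac{H_{\mathbf{k}}'(x)}{H_{\mathbf{k}}(x)}\Big),\qquad \omega(x):=\lim_{y\to x}\Omega(x,y)=\frac{H_{\mathbf{k}}''(x)}{H_{\mathbf{k}}(x)}-\frac{H_{\mathbf{k}}'(x)^2}{H_{\mathbf{k}}(x)^2}.$$ For every $x,y\in\mathbb{C}$ the following identities hold: $$\sum_{n=0}^{k_l+1}Q^{\mathbf{k}}_n(x,y)=H_{\mathbf{k}}(x)H_{\mathbf{k}}(y),$$ $$\sum_{n=0}^{k_l+1}n\,Q^{\mathbf{k}}_n(x,y)=-H_{\mathbf{k}}(x)H_{\mathbf{k}}(y)\big(\Omega(x,y)-l\big),$$ $$\sum_{n=0}^{k_l+1}n^2Q^{\mathbf{k}}_n(x,y)=H_{\mathbf{k}}(x)H_{\mathbf{k}}(y)\bigg((\Omega(x,y)-l)^2+\frac{\omega(x)+\omega(y)-2\Omega(x,y)}{(y-x)^2}\bigg).$$ At points where the expression on a right-hand side is not defined (that is, $x=y$, or $H_{\mathbf{k}}(x)=0$,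 or $H_{\mathbf{k}}(y)=0$), it is understood through its continuous extension.
   Context: $\mathbb{N}$ is the set of positive integers. A Krein-Adler sequence is a strictly increasing sequence $\mathbf{k}=(k_1,\dots,k_l)\in\mathbb{N}^l$ such that $l$ is even and $k_{2i}=k_{2i-1}+1$ for all $1\leqslant i\leqslant l/2$. $H_n(x)$ denotes the (physicists') Hermite polynomials, $H_n(x)=(-1)^n e^{x^2}\frac{d^n}{dx^n}e^{-x^2}$. The Wronskian is $\mathrm{Wr}[f_1,\dots,f_m]=\det[\partial_x^{i-1}f_j(x)]_{1\leqslant i,j\leqslant m}$. $H_{\mathbf{k}}(x):=\mathrm{Wr}[H_{k_1}(x),\dots,H_{k_l}(x)]$ and, for $n\in\mathbb{Z}_{\geqslant 0}$, $H_{\mathbf{k},n}(x):=\mathrm{Wr}[H_{k_1}(x),\dots,H_{k_l}(x),H_n(x)]$. For $|z|<1$ and $x,y\in\mathbb{C}$, $$E(z,x,y):=\sum_{n\geqslant 0} z^n\frac{H_n(x)H_n(y)}{2^n n!}=\frac{1}{\sqrt{1-z^2}}\exp\Big(\frac{2xyz-z^2(x^2+y^2)}{1-z^2}\Big)$$ (principal branch), and $$E_{\mathbf{k}}(z,x,y):=\sum_{n\in\mathbb{Z}_{\geqslant 0}\setminus\mathbf{k}} z^n\frac{H_{\mathbf{k},n}(x)H_{\mathbf{k},n}(y)}{2^{n+l}\,n!\,\prod_{j=1}^l(n-k_j)},$$ where $\mathbb{Z}_{\geqslant 0}\setminus\mathbf{k}$ means the nonnegative integers different from $k_1,\dots,k_l$;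 the series converges for all $|z|<1$, $x,y\in\mathbb{C}$. Polynomials $Q^{\mathbf{k}}_n(x,y)$ with the stated property exist and are unique. *)

(* Defs.v *)
From HB Require Import structures.
From mathcomp Require Import all_boot all_order all_algebra.
From mathcomp Require Import all_classical all_reals all_analysis.
From mathcomp Require Import complex ring.

Set Implicit Arguments.
Unset Strict Implicit.
Unset Printing Implicit Defensive.
Import Order.TTheory GRing.Theory Num.Theory.
Import numFieldNormedType.Exports.
Local Open Scope classical_set_scope.
Local Open Scope ring_scope.

(* Stated at [numClosedFieldType], so that the topology of the modulus, which
   is attached to numeric fields but not to [complex R], is inferred. *)
Definition C (R : realType) : numClosedFieldType := complex R.

(* Indices of [nth] start at 0: the pairs (k_{2i-1}, k_{2i}), 1 <= i <= l/2,
   are the entries (2i, 2i+1), 0 <= i < l/2.  The empty sequence is allowed. *)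
Definition krein_adler (k : seq nat) : Prop :=
  [/\ sorted ltn k, all (ltn 0) k, ~~ odd (size k) &
      forall i, (i < (size k)./2)%N -> nth 0%N k i.*2.+1 = (nth 0%N k i.*2).+1].

Definition rodrigues (R : realType) (n : nat) (x : R) : R :=
  (-1) ^+ n * expR (x ^+ 2) * derive1n n (fun t : R => expR (- t ^+ 2)) x.

Definition hermite (R : realType) (n : nat) : {poly R} :=
  xget 0 [set p : {poly R} | forall x, p.[x] = rodrigues n x].

Lemma hermiteP (R : realType) (n : nat) (x : R) :
  (hermite R n).[x] = rodrigues n x.
Proof.
pose h m : {poly R} := iter m (fun p => p^`() - 2 *: 'X * p) 1.
have hE m : derive1n m (fun t : R => expR (- t ^+ 2)) =
    (fun t => (h m).[t] * expR (- t ^+ 2)).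
  elim: m => [|m IHm]; first by apply/funext => t; rewrite /= hornerC mul1r.
  rewrite derive1nS IHm; apply/funext => t.
  have dp := is_derive_poly (h m) t.
  have dq : is_derive t (1 : R) (fun u : R => - u ^+ 2) (- (2 * t)).
    have := is_derive_poly (- 'X^2) t.
    rewrite (_ : horner _ = (fun u : R => - u ^+ 2)); last first.
      by apply/funext => u; rewrite !hornerE.
    by rewrite derivN derivXn !hornerE mulr_natl.
  have de : is_derive t (1 : R) (fun u : R => expR (- u ^+ 2))
      (expR (- t ^+ 2) * - (2 * t)).
    exact: (@is_derive1_comp _ expR (fun u : R => - u ^+ 2)).
  rewrite derive1E (@derive_val _ _ _ _ _ _ _ (is_deriveM dp de)).
  by rewrite /= !hornerE /GRing.scale /=; ring.
have hex : [set p : {poly R} | forall x, p.[x] = rodrigues n x]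
    ((-1) ^+ n *: h n).
  move=> y /=; rewrite hornerZ /rodrigues hE -!mulrA; congr (_ * _).
  by rewrite mulrCA -expRD subrr expR0 mulr1.
exact: (xgetPex 0 (ex_intro _ _ hex)).
Qed.

Definition hermiteC (R : realType) (n : nat) : {poly C R} :=
  map_poly (real_complex R) (hermite R n).

Definition wronskian (K : comNzRingType) (f : seq {poly K}) : {poly K} :=
  \det (\matrix_(i < size f, j < size f) derivn i f`_j).

Definition hermiteW (R : realType) (k : seq nat) : {poly C R} :=
  wronskian [seq hermiteC R j | j <- k].

Definition hermiteWn (R : realType) (k : seq nat) (n : nat) : {poly C R} :=
  wronskian (rcons [seq hermiteC R j | j <- k] (hermiteC R n)).

Definition mehler (R : realType) (z x y : C R) : C R :=
  limn (fun N : nat => \sum_(0 <= n < N)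
    z ^+ n * ((hermiteC R n).[x] * (hermiteC R n).[y] / (2 ^+ n * n`!%:R))).

Definition mehlerW (R : realType) (k : seq nat) (z x y : C R) : C R :=
  limn (fun N : nat => \sum_(0 <= n < N | n \notin k)
    z ^+ n * ((hermiteWn R k n).[x] * (hermiteWn R k n).[y] /
      (2 ^+ (n + size k) * n`!%:R * \prod_(j <- k) (n%:R - j%:R)))).

Definition Omega (R : realType) (k : seq nat) (x y : C R) : C R :=
  let H := hermiteW R k in
  (y - x)^-1 * (H^`().[y] / H.[y] - H^`().[x] / H.[x]).

Definition omega (R : realType) (k : seq nat) (x : C R) : C R :=
  lim (Omega k x y @[y --> x^']).

Definition regular_pairs (R : realType) (k : seq nat) : set (C R * C R) :=
  [set p | [/\ p.1 != p.2, (hermiteW R k).[p.1] != 0 &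
               (hermiteW R k).[p.2] != 0]].

(* [g] is the extension by continuity to the whole of C^2 of the restriction of
   [f] to [D]; it is unique because [D] is dense. *)
Definition continuous_extension (R : realType) (D : set (C R * C R))
    (f g : C R * C R -> C R) : Prop :=
  [/\ dense D, {in D, f =1 g} & continuous g].

(* Main.v *)
Require Import Defs.
From HB Require Import structures.
From mathcomp Require Import all_boot all_order all_algebra.
From mathcomp Require Import all_classical all_reals all_analysis.
From mathcomp Require Import complex ring zify.

Set Implicit Arguments.
Unset Strict Implicit.
Unset Printing Implicit Defensive.
Import Order.TTheory GRing.Theory Num.Theory.
Import numFieldNormedType.Exports.
Local Open Scope classical_set_scope.
Local Open Scope ring_scope.

(** Why the identities hold.

    Write H for the Wronskian of the Hermite polynomials selected by k, l for
    the length of k, and W f for the Wronskian of the same polynomials followed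
    by f.  Expanding along the last column, W is a differential operator of
    order l with leading coefficients H and -H'.  Let q(z) be the polynomial
    sum of the z^n Q_n.

    The hypothesis is an identity between sums of power series in z.  Since
    |H_n(x)|^2 / (2^n n!) grows at most geometrically, both series converge near
    0, and uniqueness of power series coefficients turns it into q E = E_k for
    formal power series in z whose coefficients are polynomials in x and y
    [quotient_series].  From there on everything is algebra: formal series are a
    torsion-free module over the polynomials in z.

    The value q(1).  The series E satisfies (1-z^2) E_x = 2z(y-xz) E and its
    mirror image in y, and -2 z E_z = E_xx - 2x E_x; hence every differential
    operator sends a polynomial multiple of E to E times a rational function
    with a pole only at 1-z^2 = 0, and the leading coefficient of that pole is
    easy to follow.  Multiplying the n-th coefficient of E_k by the factors
    2(k_j-n) removes its denominator and leaves (up to sign) W_x W_y E.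
    Comparing the poles of order 2l of the two sides gives q(1) = H(x)H(y)
    [exceptional_series_quotient_at1].

    The derivatives of q at 1.  The Darboux-Crum relation says that W carries
    the Hermite operator f'' - 2x f' to a second order operator in which H
    enters rationally [crum_intertwining]; so E_k solves a heat-type equation,
    and after division by E so does q, with a term singular at z = 1
    [transport_moments].  Its first two z-derivatives at z = 1 are first order
    linear equations in x for the sums of n Q_n and of n^2 Q_n.  The expected
    right-hand sides satisfy the same equations, and the difference, suitably
    multiplied by powers of y-x, vanishes on the diagonal; a polynomial whose
    logarithmic derivative is that of H (or of H^2) and that vanishes at a point
    where H does not is zero [moment_identities].

    What is left is topological: H is not the zero polynomial, so the points
    where the right-hand sides make sense are dense, and the left-hand sides are
    polynomials, hence continuous. *)

(** * Wronskians as differential operators *)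

Lemma deriv_prod (K : comNzRingType) (I : finType) (F : I -> {poly K}) :
  (\prod_i F i)^`() = \sum_i (F i)^`() * \prod_(j | j != i) F j.
Proof.
have H (r : seq I) : uniq r -> (\prod_(i <- r) F i)^`() =
    \sum_(i <- r) (F i)^`() * \prod_(j <- r | j != i) F j.
  elim: r => [|a r IHr] /=; first by rewrite !big_nil derivC.
  case/andP=> ar /IHr{}IHr; rewrite big_cons derivM IHr [RHS]big_cons.
  rewrite [X in _ = _ * X + _]big_cons eqxx /=; congr (_ * _ + _).
    by rewrite big_seq_cond [RHS]big_seq_cond; apply: eq_bigl => j; case: eqP => [->|]; rewrite ?(negPf ar) ?andbT ?andbF.
  rewrite big_distrr /= big_seq [RHS]big_seq; apply: eq_bigr => i ir.
  by rewrite big_cons; case: eqP => [E|_]; [rewrite E ir in ar | rewrite mulrCA].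
exact: H (index_enum_uniq I).
Qed.

(** Leibniz rule applied to each term of the permutation expansion. *)
Lemma deriv_det (K : comNzRingType) n (M : 'M[{poly K}]_n) :
  (\det M)^`() =
  \sum_i \det (\matrix_(r, c) if r == i then (M r c)^`() else M r c).
Proof.
rewrite /determinant raddf_sum exchange_big /=; apply: eq_bigr => s _.
rewrite -signr_odd; set e := odd _.
have -> (p : {poly K}) : ((-1) ^+ e * p)^`() = (-1) ^+ e * p^`().
  by case: (e); rewrite ?expr0 ?expr1 ?mul1r // !mulN1r derivN.
rewrite deriv_prod -mulr_sumr; congr (_ * _).
apply: eq_bigr => i _; rewrite [RHS](bigD1 i) //= !mxE eqxx; congr (_ * _).
by apply: eq_bigr => j /negPf ji; rewrite !mxE ji.
Qed.

Section Wronskian.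
Variable K : comNzRingType.
Implicit Types (fs : seq {poly K}) (f : {poly K}).

Lemma wronskianE n fs : size fs = n ->
  wronskian fs = \det (\matrix_(i < n, j < n) derivn i fs`_j).
Proof. by move=> <-. Qed.

(** Cofactors along the last column of the Wronskian of [fs] and one more
    function: the [bump] skips row [i]. *)
Definition wcoef fs (i : nat) : {poly K} :=
  (-1) ^+ (i + size fs) *
  \det (\matrix_(r < size fs, c < size fs) derivn (bump i r) fs`_c).

Lemma wronskian_rcons fs f :
  wronskian (rcons fs f) = \sum_(i < (size fs).+1) wcoef fs i * f^`(i).
Proof.
rewrite (@wronskianE (size fs).+1) ?size_rcons //.
rewrite (expand_det_col _ ord_max); apply: eq_bigr => i _.
rewrite mxE nth_rcons ltnn eqxx mulrC; congr (_ * _).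
rewrite /cofactor /wcoef /=; congr (_ * \det _).
by apply/matrixP => r c; rewrite !mxE lift_max nth_rcons ltn_ord.
Qed.

Lemma wcoef_size fs : wcoef fs (size fs) = wronskian fs.
Proof.
rewrite /wcoef addnn -signr_odd odd_double expr0 mul1r; congr (\det _).
by apply/matrixP => r c; rewrite !mxE /bump leqNgt ltn_ord.
Qed.

(** In the derivative of a Wronskian only the last row contributes: elsewhere
    the differentiated row repeats the next one. *)
Lemma wcoef_pred fs m : size fs = m.+1 -> wcoef fs m = - (wronskian fs)^`().
Proof.
move=> sz; rewrite (wronskianE sz) deriv_det big_ord_recr /= big1 ?add0r.
  rewrite /wcoef sz addnS exprS exprD -expr2 sqrr_sign mulr1 mulN1r.
  congr (- \det _); apply/matrixP => r c; rewrite !mxE /= -val_eqE /= /bump.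
  have := ltn_ord r; rewrite ltnS leq_eqVlt => /orP[/eqP -> | rm].
    by rewrite leqnn eqxx -derivnS.
  by rewrite leqNgt rm (ltn_eqF rm).
move=> i _.
apply: (determinant_alternate (i1 := widen_ord (leqnSn m) i)
  (i2 := lift ord0 i)); first by rewrite -val_eqE /= /bump /= neq_ltn ltnSn.
move=> c; rewrite !mxE eqxx /= -!val_eqE /= /bump /= add1n.
by rewrite (gtn_eqF (ltnSn i)).
Qed.

End Wronskian.

(** * Wronskians of polynomials of distinct degrees *)

Lemma coefM_top (K : nzRingType) (p q : {poly K}) a b :
  (size p <= a.+1)%N -> (size q <= b.+1)%N -> (p * q)`_(a + b) = p`_a * q`_b.
Proof.
move=> sp sq; rewrite coefM (bigD1 (inord a)) //= big1 => [|i].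
  by rewrite inordK ?ltnS ?leq_addr // addKn addr0.
rewrite -val_eqE /= inordK ?ltnS ?leq_addr // neq_ltn => /orP[ia|ai].
  by rewrite [q`_ _]nth_default ?mulr0 // (leq_trans sq) //; lia.
by rewrite nth_default ?mul0r // (leq_trans sp).
Qed.

Lemma horner_ffact (K : comNzRingType) (d i : nat) :
  (\prod_(t < i) ('X - t%:R%:P : {poly K})).[d%:R] = (d ^_ i)%:R.
Proof.
elim: i => [|i IHi]; first by rewrite big_ord0 hornerC.
rewrite big_ord_recr /= hornerM IHi !hornerE ffactnSr natrM.
have [di|id] := ltnP d i; first by rewrite ffact_small // !mul0r.
by rewrite natrB.
Qed.

(** If the Wronskian vanished, a nonzero operator of order less than n would
    annihilate all n polynomials.  Its action on the leading terms is
    multiplication by a nonzero polynomial of degree less than n in the degree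
    of the argument, which cannot have the n distinct degrees as roots. *)
Lemma wronskian_neq0 (K : numFieldType) (fs : seq {poly K}) :
  0 \notin fs -> uniq [seq size (f : {poly K}) | f <- fs] -> wronskian fs != 0.
Proof.
move=> fs0 ufs; apply/det0P => -[v /eqP v0 vM]; apply: v0.
set n := size fs in v vM *; pose w (i : 'I_n) := v 0 i * 'X^(n - i).
(* The factor X^(n-i) gives all the terms w_i X^i f^(i) the same top degree. *)
suff w0 : forall i, w i = 0.
  apply/rowP => i; rewrite mxE; apply/eqP.
  by have /eqP := w0 i; rewrite mulf_eq0 (negPf (monic_neq0 (monicXn _ _))) orbF.
pose N := \max_j size (w j).
have sw j : (size (w j) <= N)%N by rewrite /N (leq_bigmax j).
have [N0|N0] := posnP N.
  by move=> i; apply/eqP; rewrite -size_poly_eq0 -leqn0 -N0.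
pose u i := (w i)`_N.-1.
have fsj j : (j < n)%N -> fs`_j != 0.
  by move=> jn; apply: contraNneq fs0 => <-; rewrite mem_nth.
have key (j : 'I_n) : \sum_i u i * ((size fs`_j).-1 ^_ i)%:R = 0.
  set d := (size fs`_j).-1.
  have Sd : size fs`_j = d.+1 by rewrite /d prednK // size_poly_gt0 fsj.
  have := congr1 (fun M : 'rV_n => ('X^n * M 0 j)`_(N.-1 + d)) vM.
  rewrite !mxE mulr0 coef0 mulr_sumr coef_sum => E.
  apply: (mulfI (x := lead_coef fs`_j)); first by rewrite lead_coef_eq0 fsj.
  rewrite mulr0 -[RHS]E mulr_sumr; apply: eq_bigr => i _; rewrite mxE.
  have -> : 'X^n * (v 0 i * (fs`_j)^`(i)) = w i * ('X^i * (fs`_j)^`(i)).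
    rewrite /w -{1}(subnK (ltnW (ltn_ord i))) exprD; ring.
  rewrite coefM_top ?prednK //.
    rewrite mulrCA; congr (_ * _); rewrite coefXnM; case: ltnP => [di|id].
      by rewrite ffact_small // mulr0.
    by rewrite coef_derivn subnKC // mulr_natr lead_coefE Sd.
  rewrite -/d; apply/leq_sizeP => t dt; rewrite coefXnM.
  case: ltnP => // it; rewrite coef_derivn subnKC // nth_default ?mul0rn //.
  by rewrite Sd.
(* The polynomial in the degree: falling factorials form a basis. *)
pose P := \sum_(i < n) u i *: \prod_(t < i) ('X - t%:R%:P : {poly K}).
have P0 : P = 0.
  apply/eqP; apply/negP => /negP nP.
  pose rs := [seq ((size (f : {poly K})).-1)%:R : K | f <- fs].
  have /(max_poly_roots nP) : all (root P) rs.
    apply/allP => _ /mapP[f ffs ->]; apply/rootP.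
    have jn : (index f fs < n)%N by rewrite index_mem.
    have := key (Ordinal jn); rewrite /= nth_index // => <-.
    rewrite /P horner_sum; apply: eq_bigr => i _.
    by rewrite hornerZ horner_ffact.
  have urs : uniq rs.
    rewrite /rs map_inj_in_uniq; first exact: map_uniq ufs.
    move=> f g ff gf /eqP; rewrite eqr_nat => /eqP E.
    have E' : size f = size g.
      have := fs0; have f0 : f != 0 by apply: contraNneq fs0 => <-.
      have g0 : g != 0 by apply: contraNneq fs0 => <-.
      by move: f0 g0; rewrite -!size_poly_gt0 => /prednK <- /prednK <-; rewrite E.
    move: E'; rewrite -(nth_index 0 ff) -(nth_index 0 gf).
    move/eqP; rewrite -!(nth_map 0 0%N (fun f : {poly K} => size f)) ?index_mem //.
    by rewrite nth_uniq ?size_map ?index_mem // => /eqP ->.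
  rewrite size_map -/n => /(_ urs); rewrite ltnNge => /negP; apply.
  apply: (leq_trans (size_sum _ _ _)); apply/bigmax_leqP => i _.
  apply: (leq_trans (size_scale_leq _ _)).
  by rewrite size_prod_XsubC -sum1_size sum1_card card_ord.
(* Evaluation at 0, 1, 2, ... is triangular in the falling factorial basis. *)
have u0 (i : 'I_n) : u i = 0.
  have [m] := ubnP (i : nat); elim: m i => // m IHm i im.
  have := congr1 (horner^~ i%:R) P0; rewrite hornerC /P horner_sum (bigD1 i) //=.
  rewrite [X in _ + X]big1 => [|j]; last first.
    rewrite -val_eqE /= neq_ltn hornerZ horner_ffact => /orP[ji|ij].
      by rewrite IHm ?mul0r // (leq_trans ji).
    by rewrite ffact_small // mulr0.
  rewrite addr0 hornerZ horner_ffact ffactnn => /eqP.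
  by rewrite mulf_eq0 pnatr_eq0 gtn_eqF ?fact_gt0 // orbF => /eqP.
have [i0 Ei0] : {i0 | \max_j size (w j) = size (w i0)}.
  apply: bigop.eq_bigmax; rewrite card_ord lt0n; apply: contraTneq N0 => n0.
  by rewrite -leqNgt; apply/bigmax_leqP => i; have := ltn_ord i; rewrite {2}n0.
move=> j; have := u0 i0; rewrite /u /N Ei0 -lead_coefE => /eqP.
by rewrite lead_coef_eq0 -size_poly_eq0 -Ei0 gtn_eqF.
Qed.

(** * The Darboux-Crum relation *)

Lemma derivn_mulX (K : nzRingType) (p : {poly K}) i :
  ('X * p)^`(i) = 'X * p^`(i) + p^`(i.-1) *+ i.
Proof.
elim: i => [|i IHi]; first by rewrite mulr0n addr0.
rewrite derivnS IHi derivD derivM derivX mul1r derivMn -derivnS.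
case: i {IHi} => [|i]; first by rewrite !addr0 addrC.
by rewrite -derivnS addrAC addrC -mulrS /=.
Qed.

Section Intertwining.
Variables (K : comNzRingType) (l : nat) (H : {poly K}) (c : nat -> {poly K}).
Hypothesis cl : c l = H.
Hypothesis cpred : forall m, l = m.+1 -> c m = - H^`().
Hypothesis c0 : l = 0%N -> H = 1.

Let L (f : {poly K}) := \sum_(i < l.+1) c i * f^`(i).
Let alpha (i : nat) : {poly K} :=
  H * (c i)^`()^`() - 2 * ('X * H + H^`()) * (c i)^`() +
  (H^`()^`() + 2 * 'X * H^`() - (2 * l)%:R * H) * c i + (2 * i)%:R * H * c i.
Let beta (i : nat) : {poly K} := 2 * (H * (c i)^`() - H^`() * c i).

(** For an operator L of order l with leading coefficients H and -H', the two
    sides of the Darboux-Crum relation differ by an operator of order less than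
    l: the terms of order l+2, l+1 and l cancel, the last one precisely because
    the subleading coefficient is -H'. *)
Lemma intertwining_defect : exists gamma : nat -> {poly K}, forall f,
  H * (L f)^`()^`() - 2 * ('X * H + H^`()) * (L f)^`() +
  (H^`()^`() + 2 * 'X * H^`() - (2 * l)%:R * H) * L f
  - H * L (f^`()^`() - 2 *: ('X * f^`())) = \sum_(i < l) gamma i * f^`(i).
Proof.
pose gamma i := alpha i + (if i is j.+1 then beta j else 0).
exists gamma => f; transitivity
    (\sum_(i < l.+1) (alpha i * f^`(i) + beta i * f^`(i.+1))).
  rewrite /L !raddf_sum /= !mulr_sumr -!sumrN -!big_split /=.
  apply: eq_bigr => i _; rewrite derivnB derivnZ derivn_mulX.
  have E j : f^`(j)^`() = f^`(j.+1) by [].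
  have E' j : f^`()^`(j) = f^`(j.+1) by rewrite /derivn -iterSr.
  have E2 : f^`()^`()^`(i) = f^`(i.+2) by rewrite /derivn -!iterSr.
  have E'' : f^`()^`(i.-1) *+ i = i%:R * f^`(i).
    by rewrite mulr_natl E'; case: (i : nat).
  rewrite E'' E2 E' !derivM derivD !derivM !E /alpha /beta -mul_polyC.
  have -> : (2%:P : {poly K}) = 2 by rewrite polyCMn.
  ring.
have bl : beta l = 0 by rewrite /beta cl; ring.
rewrite big_split /= [X in _ + X]big_ord_recr /= bl mul0r addr0.
rewrite big_ord_recr /=; case El : l => [|m].
  rewrite !big_ord0 add0r addr0 /alpha -{-2}El cl c0 // El.
  by rewrite derivC deriv0 !(mulr0, mul0r, addr0, subr0).
have top : alpha m.+1 * f^`(m.+1) + beta m * f^`(m.+1) = 0.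
  rewrite /alpha /beta -El cl (cpred El) derivN; ring.
rewrite [X in _ + X]big_ord_recr /= addrACA top addr0.
under [RHS]eq_bigr do rewrite mulrDl.
rewrite big_split /= [X in _ = _ + X]big_ord_recl mul0r add0r.
by [].
Qed.
End Intertwining.

Section Crum.
Variables (K : idomainType) (fs : seq {poly K}).
Let l := size fs.
Let H := wronskian fs.
Let W f := wronskian (rcons fs f).

Lemma wronskian_rconsZ a f : W (a *: f) = a *: W f.
Proof.
rewrite /W !wronskian_rcons scaler_sumr; apply: eq_bigr => i _.
by rewrite derivnZ scalerAr.
Qed.

Lemma wronskian_rcons_mem f : f \in fs -> W f = 0.
Proof.
move=> ffs; rewrite /W (@wronskianE _ (size fs).+1) ?size_rcons // -det_tr.
have fl : (index f fs < (size fs).+1)%N by rewrite ltnS index_size.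
apply: (determinant_alternate (i1 := ord_max) (i2 := Ordinal fl)).
  by rewrite -val_eqE /= gtn_eqF // index_mem.
by move=> i; rewrite !mxE !nth_rcons ltnn eqxx /= index_mem ffs nth_index.
Qed.

(** The defect, of order less than l, annihilates the l functions of [fs],
    because W kills them and the Hermite operator only rescales them; as their
    Wronskian is not zero, the defect is zero. *)
Lemma crum_intertwining :
    (forall f, f \in fs -> exists a, f^`()^`() - 2 *: ('X * f^`()) = a *: f) ->
    H != 0 -> forall f,
  H * (W f)^`()^`() - 2 * ('X * H + H^`()) * (W f)^`() +
  (H^`()^`() + 2 * 'X * H^`() - (2 * l)%:R * H) * W f =
  H * W (f^`()^`() - 2 *: ('X * f^`())).
Proof.
move=> eig H0 f.
have [|l0|gamma Egamma] :=
    @intertwining_defect K l H (wcoef fs) (wcoef_size fs).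
- exact: wcoef_pred.
- rewrite /H (wronskianE l0); exact: det_mx00.
have LW g : \sum_(i < l.+1) wcoef fs i * g^`(i) = W g.
  by rewrite /W wronskian_rcons.
have EG g : H * (W g)^`()^`() - 2 * ('X * H + H^`()) * (W g)^`() +
    (H^`()^`() + 2 * 'X * H^`() - (2 * l)%:R * H) * W g
    - H * W (g^`()^`() - 2 *: ('X * g^`())) = \sum_(i < l) gamma i * g^`(i).
  by rewrite -Egamma -!LW.
pose M := \matrix_(i < l, j < l) (fs`_j)^`(i).
pose v := \row_(i < l) gamma i.
have vM : v *m M = 0.
  apply/rowP => j; rewrite !mxE; under eq_bigr do rewrite !mxE.
  rewrite -EG.
  have jfs : fs`_j \in fs by rewrite mem_nth.
  have [a ->] := eig _ jfs.
  by rewrite wronskian_rconsZ wronskian_rcons_mem // scaler0 !deriv0 !(mulr0, subr0, addr0).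
have v0 : v = 0.
  apply/eqP; apply: contraTT H0 => v0; rewrite negbK; apply/det0P.
  by exists v.
apply/eqP; rewrite -subr_eq0 EG big1 // => i _.
have := congr1 (fun u : 'rV_l => u 0 i) v0; rewrite !mxE => ->.
by rewrite mul0r.
Qed.
End Crum.

(** * Formal power series and their poles at z = 1 *)

(** Formal power series in z, seen only as a module over the polynomials in z:
    products of two series are never needed.  A separate name is used so that
    the scaling below is convolution and not the pointwise one. *)
Definition zseries (A : comNzRingType) : Type := nat -> A.

HB.instance Definition _ (A : comNzRingType) :=
  GRing.Zmodule.copy (zseries A) (nat -> A).

Section ZSeriesModule.
Variable A : comNzRingType.
Implicit Types (p q : {poly A}) (s t : zseries A).

Definition zconv p s : zseries A :=
  fun n => \sum_(j < n.+1) p`_j * s (n - j)%N.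

Lemma zconvE p s n N : (n <= N)%N ->
  zconv p s n = (p * \poly_(i < N.+1) s i)`_n.
Proof.
move=> nN; rewrite coefM; apply: eq_bigr => j _; rewrite coef_poly.
by rewrite ltnS (leq_trans (leq_subr _ _) nN).
Qed.

Lemma zconvA p q s : zconv p (zconv q s) = zconv (p * q) s.
Proof.
apply/funext => n; rewrite [RHS](zconvE _ _ (leqnn n)) -mulrA coefM.
apply: eq_bigr => j _; congr (_ * _); apply: zconvE.
exact: leq_subr.
Qed.

Lemma zconv1 : left_id 1 zconv.
Proof.
move=> s; apply/funext => n; rewrite /zconv big_ord_recl big1 => [|j _].
  by rewrite coef1 mul1r addr0 subn0.
by rewrite coef1 mul0r.
Qed.

Lemma zconvDr : right_distributive zconv +%R.
Proof.
move=> p s t; apply/funext => n; rewrite /zconv /= -[RHS]big_split /=.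
by apply: eq_bigr => j _; rewrite -mulrDr.
Qed.

Lemma zconvDl s : {morph zconv^~ s : p q / p + q}.
Proof.
move=> p q; apply/funext => n; rewrite /zconv /= -[RHS]big_split /=.
by apply: eq_bigr => j _; rewrite coefD mulrDl.
Qed.

HB.instance Definition _ := GRing.Zmodule_isLmodule.Build {poly A} (zseries A)
  zconvA zconv1 zconvDr zconvDl.

Lemma zseriesDE s t n : (s + t) n = s n + t n. Proof. by []. Qed.
Lemma zseriesNE s n : (- s) n = - s n. Proof. by []. Qed.
Lemma zscaleE p s n : (p *: s) n = \sum_(j < n.+1) p`_j * s (n - j)%N.
Proof. by []. Qed.

Lemma zscaleC (a : A) s n : (a%:P *: s) n = a * s n.
Proof.
rewrite zscaleE big_ord_recl big1 => [|j _]; last by rewrite coefC mul0r.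
by rewrite coefC addr0 subn0.
Qed.

Lemma zscaleX s n : ('X *: s) n = if n is m.+1 then s m else 0.
Proof.
case: n => [|n]; first by rewrite zscaleE big_ord1 coefX mul0r.
rewrite zscaleE 2!big_ord_recl big1 => [|j _]; last by rewrite coefX mul0r.
by rewrite !coefX mul0r mul1r add0r addr0 /= subSS subn0.
Qed.

(** A series with constant term 1 is torsion-free. *)
Lemma zscale_eq0 p s : s 0%N = 1 -> p *: s = 0 -> p = 0.
Proof.
move=> s0 ps; apply/polyP => n; rewrite coef0.
have [m] := ubnP n; elim: m n => // m IHm n nm.
have := congr1 (fun t : zseries A => t n) ps; rewrite zscaleE.
rewrite big_ord_recr /= subnn s0 mulr1 big1 ?add0r // => j _.
by rewrite IHm ?mul0r // (leq_trans (ltn_ord j)).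
Qed.

End ZSeriesModule.

Section Derivations.
Variables (A : comNzRingType) (D : {additive A -> A}).
Hypothesis DM : forall a b, D (a * b) = D a * b + a * D b.
Implicit Types (p q : {poly A}) (s t : zseries A).

Definition zder (F : A -> A) s : zseries A := fun n => F (s n).

Lemma derivation1 : D 1 = 0.
Proof.
have := DM 1 1; rewrite !mulr1 mul1r => /eqP.
by rewrite -subr_eq0 opprD addNKr oppr_eq0 => /eqP.
Qed.

Lemma map_derivM p q :
  map_poly D (p * q) = map_poly D p * q + p * map_poly D q.
Proof.
apply/polyP => n; rewrite coefD coef_map !coefM raddf_sum -big_split /=.
by apply: eq_bigr => j _; rewrite DM !coef_map.
Qed.

Lemma zderM p s : zder D (p *: s) = map_poly D p *: s + p *: zder D s.
Proof.
apply/funext => n; rewrite /zder zseriesDE !zscaleE raddf_sum -big_split /=.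
by apply: eq_bigr => j _; rewrite DM coef_map.
Qed.

Lemma zderD s t : zder D (s + t) = zder D s + zder D t.
Proof. by apply/funext => n; rewrite /zder zseriesDE raddfD. Qed.

End Derivations.

Section Number.
Variable (A : comNzRingType).
Implicit Types (p q : {poly A}) (s t : zseries A).

(** The operator -2 z d/dz, normalised as the eigenvalue of the Hermite operator
    f'' - 2x f' on H_n. *)
Definition znum s : zseries A := fun n => s n * (- (2 * n)%:R).

Lemma znumM p s :
  znum (p *: s) = (- 2 * ('X * p^`())) *: s + p *: znum s.
Proof.
apply/funext => n; rewrite zseriesDE /znum !zscaleE mulr_suml -big_split /=.
apply: eq_bigr => j _; rewrite -mulrA -polyC1 -polyCMn -polyCN coefCM coefXM.
case: j => j /=; rewrite ltnS => jn; set i := (n - j)%N.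
have -> : n = (i + j)%N by rewrite subnK.
case: j {jn} @i => [|j] i /=; first by rewrite addn0; ring.
by rewrite coef_deriv; ring.
Qed.
End Number.

Section Symbol.
Variables (A : idomainType) (E : zseries A).
Hypothesis E0 : E 0%N = 1.
Implicit Types (p q : {poly A}) (s t : zseries A).

(** [zsymbol m v s] says that s is E times a rational function p / (1-z^2)^m,
    and v = p(1) is the leading coefficient of its pole of order m at z = 1; it
    is 0 when the pole has smaller order. *)
Definition zsymbol (m : nat) (v : A) s :=
  exists2 p, (1 - 'X^2) ^+ m *: s = p *: E & p.[1] = v.

Lemma zsymbol_uniq m v w s : zsymbol m v s -> zsymbol m w s -> v = w.
Proof.
case=> p Ep <- [q Eq <-]; congr horner; apply/eqP; rewrite -subr_eq0.
apply/eqP/(zscale_eq0 E0); by rewrite scalerBl -Ep -Eq subrr.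
Qed.

Lemma zsymbolD m v w s t :
  zsymbol m v s -> zsymbol m w t -> zsymbol m (v + w) (s + t).
Proof.
case=> p Ep <- [q Eq <-]; exists (p + q); last by rewrite hornerD.
by rewrite scalerDr scalerDl Ep Eq.
Qed.

Lemma zsymbolZ m v q s : zsymbol m v s -> zsymbol m (q.[1] * v) (q *: s).
Proof.
case=> p Ep <-; exists (q * p); last by rewrite hornerM.
by rewrite scalerA mulrC -scalerA Ep scalerA.
Qed.

Lemma zsymbol_lift m n v s : zsymbol m v s -> zsymbol (m + n.+1) 0 s.
Proof.
case=> p Ep _; exists ((1 - 'X^2) ^+ n.+1 * p).
  by rewrite addnC exprD -scalerA Ep scalerA.
by rewrite hornerM horner_exp !hornerE; rewrite expr1n subrr expr0n !mul0r.
Qed.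

Lemma zsymbol_base q : zsymbol 0 q.[1] (q *: E).
Proof. by exists q => //; rewrite expr0 scale1r. Qed.

Section Der.
Variables (D : {additive A -> A}) (g : {poly A}).
Hypothesis DM : forall a b, D (a * b) = D a * b + a * D b.
Hypothesis DE : (1 - 'X^2) *: zder D E = g *: E.

Lemma map_deriv_rho m : map_poly D ((1 - 'X^2) ^+ m) = 0.
Proof.
have c1 : map_poly D 1 = 0 by rewrite -polyC1 map_polyC derivation1.
have DX : map_poly D 'X = 0.
  apply/polyP => i; rewrite coef_map coefX coef0.
  by case: (i == 1%N); rewrite ?derivation1 ?raddf0.
elim: m => [|m IHm]; first by rewrite expr0.
rewrite exprS map_derivM // IHm mulr0 addr0 raddfB /= c1 expr2.
by rewrite map_derivM // DX !(mul0r, mulr0, subr0, addr0).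
Qed.

(** Differentiating E produces the factor g / (1-z^2), while the derivative of p
    only contributes a pole of lower order. *)
Lemma zsymbol_der m v s :
  zsymbol m v s -> zsymbol m.+1 (g.[1] * v) (zder D s).
Proof.
case=> p Ep <-; exists ((1 - 'X^2) * map_poly D p + g * p); last first.
  by rewrite !hornerE; rewrite expr1n subrr mul0r add0r.
have := congr1 (zder D) Ep; rewrite !zderM // map_deriv_rho scale0r add0r => Ep'.
rewrite exprS -scalerA Ep' scalerDr scalerA [RHS]scalerDl; congr (_ + _).
by rewrite scalerA mulrC -scalerA DE scalerA mulrC.
Qed.

(** Only the top order term of a differential operator raises the pole enough
    to be seen. *)
Lemma zsymbol_diffop (c : nat -> A) (l m : nat) v s : zsymbol m v s ->
  zsymbol (m + l) (c l * g.[1] ^+ l * v)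
    (\sum_(i < l.+1) (c i)%:P *: iter i (zder D) s).
Proof.
move=> sv.
have it i : zsymbol (m + i) (g.[1] ^+ i * v) (iter i (zder D) s).
  elim: i => [|i IHi]; first by rewrite addn0 expr0 mul1r.
  by rewrite addnS exprS -mulrA; apply: zsymbol_der.
rewrite big_ord_recr /= -[_ * v]add0r; apply: zsymbolD; last first.
  by rewrite -mulrA -{1}(hornerC (c l) 1); apply: zsymbolZ.
elim/big_ind: _ => [|s1 s2 h1 h2|i _].
- by exists 0; rewrite ?scaler0 ?scale0r ?horner0.
- by rewrite -[0]addr0; apply: zsymbolD.
- have -> : (m + l = m + i + (l - i).-1.+1)%N.
    by have := ltn_ord i; lia.
  by apply: (zsymbol_lift _ (zsymbolZ _ (it i))).
Qed.
End Der.

(** The derivatives of p and of the power of 1-z^2 raise the order of the pole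
    by at most 1, hence do not contribute. *)
Lemma zsymbol_num k m v s : zsymbol 2 k (znum E) ->
  zsymbol m v s -> zsymbol m.+2 (k * v) (znum s).
Proof.
case=> kap Ek <- [p Ep <-]; have := congr1 (@znum A) Ep.
rewrite !znumM => /(congr1 (fun t => (1 - 'X^2) ^+ 2 *: t)).
rewrite !scalerDr !scalerA => E2.
exists (kap * p - 2 * (1 - 'X^2) * ((1 - 'X^2) * ('X * p^`()) + 2 * m%:R * 'X^2 * p)); last first.
  by rewrite !hornerE expr1n subrr !(mulr0, mul0r, subr0).
have {}E2 : (1 - 'X^2) ^+ m.+2 *: znum s =
    ((1 - 'X^2) ^+ 2 * (-2 * ('X * p^`()))) *: E +
    (p * (1 - 'X^2) ^+ 2) *: znum E -
    ((1 - 'X^2) ^+ 2 * (-2 * ('X * ((1 - 'X^2) ^+ m)^`()))) *: s.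
  by rewrite [p * _]mulrC -E2 [RHS]addrC addKr; congr (_ *: _); rewrite -exprD.
rewrite E2 -[(p * _) *: _]scalerA Ek scalerA.
have -> : (1 - 'X^2) ^+ 2 * (-2 * ('X * ((1 - 'X^2) ^+ m)^`())) =
   (1 - 'X^2) * (4 * m%:R * 'X^2) * (1 - 'X^2) ^+ m :> {poly A}.
  rewrite deriv_exp derivB derivXn derivC.
  case: m {Ep E2} => [|m]; first by rewrite mulr0n; ring.
  by rewrite -[_ *+ m.+1]mulr_natr [(1 - 'X^2) ^+ m.+1]exprS /=; ring.
rewrite -[(_ * (1 - 'X^2) ^+ m) *: s]scalerA Ep scalerA -scalerDl -scalerBl; congr (_ *: _); ring.
Qed.

Lemma zsymbol_prodnum k m v s (r : seq nat) : zsymbol 2 k (znum E) ->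
  zsymbol m v s -> zsymbol (m + (size r).*2) (k ^+ size r * v)
    (fun n => \prod_(j <- r) (2 * (j%:R - n%:R)) * s n).
Proof.
move=> hk hs; elim: r => [|j r IHr].
  rewrite addn0 expr0 mul1r (_ : (fun n => _) = s) //.
  by apply/funext => n; rewrite big_nil mul1r.
set t : zseries A := (fun n => _) in IHr.
rewrite (_ : (fun n => _) = znum t + ((2 * j)%:R)%:P *: t); last first.
  apply/funext => n; rewrite big_cons zseriesDE zscaleC /znum /t; ring.
rewrite /= doubleS !addnS exprS -mulrA -[_ * (_ * v)]addr0; apply: zsymbolD.
  exact: zsymbol_num.
by rewrite -addn2; exact: (zsymbol_lift 1 (zsymbolZ _ IHr)).
Qed.

End Symbol.

(** * Hermite polynomials and the Mehler series *)

Fixpoint herm (K : comNzRingType) (n : nat) : {poly K} :=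
  if n is m.+1 then 2 *: ('X * herm K m) - (herm K m)^`() else 1.

Section Herm.
Variable K : comNzRingType.
Local Notation h := (herm K).

Lemma hermS n : h n.+1 = 2 *: ('X * h n) - (h n)^`(). Proof. by []. Qed.

Lemma deriv_herm n : (h n.+1)^`() = (2 * n.+1)%:R *: h n.
Proof.
elim: n => [|n IHn].
  by rewrite hermS /= -polyC1 derivC subr0 mulr1 derivZ derivX muln1.
rewrite hermS derivB derivZ derivM derivX mul1r IHn derivZ -!mul_polyC hermS.
rewrite -!mul_polyC !polyCMn polyC1; ring.
Qed.

Lemma herm_ode n :
  (h n)^`()^`() - 2 *: ('X * (h n)^`()) = (- (2 * n)%:R) *: h n.
Proof.
case: n => [|n].
  by rewrite /= -polyC1 derivC deriv0 mulr0 scaler0 subr0 muln0 oppr0 scale0r.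
rewrite deriv_herm derivZ hermS -!mul_polyC polyCN !polyCMn polyC1; ring.
Qed.
End Herm.

Lemma size_herm (K : numDomainType) n : size (herm K n) = n.+1.
Proof.
elim: n => [|n IHn]; first by rewrite size_poly1.
have n0 : herm K n != 0 by rewrite -size_poly_eq0 IHn.
have sX : size (2 *: ('X * herm K n)) = n.+2.
  by rewrite size_scale ?pnatr_eq0 // mulrC size_mulX // IHn.
by rewrite hermS size_polyDl ?sX // size_polyN (leq_trans (lt_size_deriv n0)) // IHn.
Qed.

Section MehlerSeries.
Variables (K : numFieldType) (A : comNzRingType).
Variables (phi psi : {rmorphism {poly K} -> A}) (D : {additive A -> A}).
Hypothesis DM : forall a b, D (a * b) = D a * b + a * D b.
Hypothesis Dphi : forall p, D (phi p) = phi p^`().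
Hypothesis Dpsi : forall p, D (psi p) = 0.
Local Notation h := (herm K).

Lemma rmorph_polyC_nat (f : {rmorphism {poly K} -> A}) m : f m%:R%:P = m%:R.
Proof. by rewrite !rmorph_nat. Qed.

(** [phi] and [psi] place a polynomial in the variable x or in the variable y.
    Keeping them abstract makes the relations below available in both
    variables. *)
Definition mehler_weight (n : nat) : K := (2 ^+ n * n`!%:R)^-1.

Definition mehler_series : zseries A :=
  fun n => phi (mehler_weight n)%:P * (phi (h n) * psi (h n)).

Lemma mehler_weightS n : mehler_weight n.+1 * (2 * n.+1)%:R = mehler_weight n.
Proof.
rewrite /mehler_weight factS exprS !natrM.
have n0 : (n`!%:R : K) != 0 by rewrite pnatr_eq0 gtn_eqF ?fact_gt0.
have n1 : (n.+1%:R : K) != 0 by rewrite pnatr_eq0.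
field; by rewrite n0 addrC natr1 n1 expf_neq0 ?pnatr_eq0.
Qed.

Lemma mehler_series0 : mehler_series 0%N = 1.
Proof. by rewrite /mehler_series /mehler_weight expr0 mul1r invr1 !rmorph1 !mulr1. Qed.

Lemma zder_iter_mehler_series i n : iter i (zder D) mehler_series n =
  phi (mehler_weight n)%:P * (phi (h n)^`(i) * psi (h n)).
Proof.
elim: i => [//|i IHi]; rewrite iterS /zder IHi !DM !Dphi Dpsi derivC rmorph0.
by rewrite mul0r add0r mulr0 addr0 -derivnS.
Qed.

(** The equation (1-z^2) E_x = 2z(y-xz) E that Mehler's closed formula implies;
    coefficientwise it is the three-term recurrence. *)
Lemma mehler_series_der : (1 - 'X^2) *: zder D mehler_series =
  ('X * (2 * psi 'X)%:P - 'X^2 * (2 * phi 'X)%:P) *: mehler_series.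
Proof.
have dE n : zder D mehler_series n = phi (mehler_weight n)%:P * (phi (h n)^`() * psi (h n)).
  exact: (zder_iter_mehler_series 1).
rewrite !scalerBl scale1r !expr2 -!scalerA.
apply/funext => n; rewrite !zseriesDE !zseriesNE !zscaleX.
case: n => [|n]; first by rewrite dE /= -polyC1 derivC rmorph0 mul0r mulr0.
rewrite !zscaleX !zscaleC !dE.
have w1 : phi (mehler_weight n.+1)%:P * (2 * n.+1%:R) = phi (mehler_weight n)%:P.
  by rewrite -(mehler_weightS n) polyCM rmorphM /= rmorph_polyC_nat natrM.
rewrite deriv_herm.
have -> : phi ((2 * n.+1)%:R *: h n) = 2 * n.+1%:R * phi (h n).
  by rewrite -mul_polyC rmorphM /= rmorph_polyC_nat natrM.
case: n w1 => [|n] w1.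
  rewrite !subr0 /mehler_series -w1 hermS /= -polyC1 derivC subr0 mulr1.
  by rewrite -mul_polyC !rmorphM /= !rmorph_polyC_nat !rmorph1; ring.
have w2 : phi (mehler_weight n.+1)%:P * (2 * n.+1%:R) = phi (mehler_weight n)%:P.
  by rewrite -(mehler_weightS n) polyCM rmorphM /= rmorph_polyC_nat natrM.
rewrite !zscaleC !dE /mehler_series -w2 -w1.
have ph : phi (h n.+1) = 2 * phi 'X * phi (h n) - phi (h n)^`().
  by rewrite hermS rmorphB -mul_polyC !rmorphM /= rmorph_polyC_nat mulrA.
have ps : psi (h n.+2) = 2 * psi 'X * psi (h n.+1) - 2 * n.+1%:R * psi (h n).
  rewrite hermS rmorphB deriv_herm -!mul_polyC !rmorphM /=.
  by rewrite !rmorph_polyC_nat natrM mulrA.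
rewrite ps ph; ring.
Qed.

Lemma mehler_series_num :
  zder D (zder D mehler_series) - (2 * phi 'X)%:P *: zder D mehler_series = znum mehler_series.
Proof.
apply/funext => n; rewrite zseriesDE zseriesNE zscaleC.
have -> : zder D (zder D mehler_series) n =
    phi (mehler_weight n)%:P * (phi (h n)^`(2) * psi (h n)).
  exact: (zder_iter_mehler_series 2).
have -> : zder D mehler_series n = phi (mehler_weight n)%:P * (phi (h n)^`() * psi (h n)).
  exact: (zder_iter_mehler_series 1).
rewrite /znum /mehler_series.
have := congr1 phi (herm_ode K n); rewrite rmorphB -!mul_polyC !rmorphM /=.
rewrite polyCN rmorphN /= !rmorph_polyC_nat => E.
have -> : phi (h n)^`(2) = 2 * (phi 'X * phi (h n)^`()) + - (2 * n)%:R * phi (h n).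
  by rewrite -E; ring.
rewrite /=; ring.
Qed.

End MehlerSeries.

(** From -2z E_z = E_xx - 2x E_x: only E_xx has a pole of order 2. *)
Lemma zsymbol_znum_mehler_series (K : numFieldType) (A : idomainType)
    (phi psi : {rmorphism {poly K} -> A}) (D : {additive A -> A}) :
    (forall a b, D (a * b) = D a * b + a * D b) ->
    (forall p, D (phi p) = phi p^`()) -> (forall p, D (psi p) = 0) ->
  let E := mehler_series phi psi in
  zsymbol E 2 ((2 * (psi 'X - phi 'X)) ^+ 2) (znum E).
Proof.
move=> DM Dphi Dpsi E.
set g := 'X * (2 * psi 'X)%:P - 'X^2 * (2 * phi 'X)%:P.
have g1 : g.[1] = 2 * (psi 'X - phi 'X).
  rewrite /g hornerD hornerN !(hornerM, hornerX, hornerC); ring.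
have dE : (1 - 'X^2) *: zder D E = g *: E by exact: mehler_series_der.
have E0 : zsymbol E 0 1 E by rewrite -[X in zsymbol _ _ X](hornerC 1 1) -[X in zsymbol _ _ _ X]scale1r; apply: zsymbol_base.
have s1 := zsymbol_der DM dE E0; have s2 := zsymbol_der DM dE s1.
rewrite -(mehler_series_num DM Dphi Dpsi) -scaleNr.
have s3 := zsymbol_lift 0 (zsymbolZ (- (2 * phi 'X)%:P) s1).
have := zsymbolD s2 s3; rewrite addr0 mulr1 g1 -expr2; apply.
Qed.

(** * Polynomials determined by their logarithmic derivative *)

Section LogDeriv.
Variable B : idomainType.
Hypothesis B0 : forall n, n.+1%:R != 0 :> B.
Implicit Types P X : {poly B}.

(** Compare the leading coefficients of the two products, which carry the degrees
    of P and of X. *)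
Lemma logderiv_size P X :
  P != 0 -> X != 0 -> P * X^`() = P^`() * X -> size P = size X.
Proof.
have top (Q : {poly B}) : (size ('X * Q^`())%R <= size Q)%N /\
    ('X * Q^`())`_(size Q).-1 = Q`_(size Q).-1 *+ (size Q).-1.
  split; last first.
    rewrite coefXM coef_deriv; case: (size Q).-1 => //=.
  apply/leq_sizeP => -[|j] Qj; rewrite coefXM //= coef_deriv.
  by rewrite nth_default ?mul0rn.
move=> P0 X0 E; have /esym/eqP := congr1 (fun Q => ('X * Q)`_((size P).-1 + (size X).-1)) E.
have [sP cP] := top P; have [sX cX] := top X.
have S (Q : {poly B}) : Q != 0 -> (size Q <= (size Q).-1.+1)%N.
  by rewrite -size_poly_gt0 => /prednK ->.
rewrite mulrA mulrCA !coefM_top ?(leq_trans sP) ?(leq_trans sX) ?S //.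
rewrite cP cX -!lead_coefE -[_ *+ (size P).-1]mulr_natr.
rewrite -[_ *+ (size X).-1]mulr_natr -subr_eq0.
set p := lead_coef P; set x := lead_coef X.
rewrite (_ : _ - _ = p * x * ((size P).-1%:R - (size X).-1%:R)); last by ring.
rewrite !mulf_eq0 !lead_coef_eq0 (negPf P0) (negPf X0) /=.
move: P0 X0; rewrite -!size_poly_gt0 => /prednK {2}<- /prednK {2}<-.
move: (size P).-1 (size X).-1 => a b; rewrite subr_eq0 => /eqP ab; congr _.+1.
have aux (i j : nat) : (i < j)%N -> i%:R = j%:R :> B -> False.
  move=> ij /eqP; rewrite eq_sym -subr_eq0 -natrB ?(ltnW ij) //.
  by rewrite -(prednK (n := (j - i))) ?subn_gt0 // (negPf (B0 _)).
by case: (ltngtP a b) => // h; [case: (aux _ _ h) | case: (aux _ _ h)].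
Qed.

(** By degrees, lc(P) X - lc(X) P, which solves the same equation, is zero; so X
    is proportional to P. *)
Lemma logderiv_uniq P X a :
  P.[a] != 0 -> X.[a] = 0 -> P * X^`() = P^`() * X -> X = 0.
Proof.
move=> Pa Xa E; have P0 : P != 0 by apply: contraNneq Pa => ->; rewrite horner0.
apply/eqP; apply/negPn/negP => X0.
have S := logderiv_size P0 X0 E.
pose Y := lead_coef P *: X - lead_coef X *: P.
have EY : P * Y^`() = P^`() * Y.
  rewrite /Y derivB !derivZ !mulrBr -!scalerAr E; congr (_ - _).
  by rewrite mulrC.
have Y0 : Y = 0.
  apply/eqP; apply/negPn/negP => Y0; have SY := logderiv_size P0 Y0 EY.
  have /negP := Y0; apply; rewrite -lead_coef_eq0 lead_coefE -SY.
  by rewrite /Y coefB !coefZ [in X in X - _]S -!lead_coefE mulrC subrr.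
have := congr1 (horner^~ a) Y0; rewrite /Y !hornerE Xa mulr0 sub0r => /eqP.
by rewrite oppr_eq0 mulf_eq0 lead_coef_eq0 (negPf X0) (negPf Pa).
Qed.

(** Here the polynomial variable is x and [a] stands for y, so that g, g1, g2 are
    H(y), H'(y), H''(y).  The first hypothesis says that the difference X of the
    two sides of the first conclusion satisfies H X' = H' X; together with its
    derivative and the second hypothesis, it says that the difference Z of the
    sides of the second conclusion satisfies H Z' = 2 H' Z.  Both vanish at
    x = y. *)
Lemma moment_identities (l : nat) (a : B) (H M1 M2 : {poly B}) (g g1 g2 : B) :
  let w := a%:P - 'X in let G := g%:P in let G1 := g1%:P in let G2 := g2%:P in
  H.[a] = g -> H^`().[a] = g1 -> H^`()^`().[a] = g2 -> g != 0 ->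
  w * (H * M1^`() - H^`() * M1) - H * M1 =
    G * (H * H^`()^`() - H^`() ^+ 2 - l%:R * H ^+ 2) ->
  w * (H * M2^`() - H^`() * M2) - 2 * H * M2 =
    H * M1^`()^`() - 2 * H^`() * M1^`() + (H^`()^`() - 2 * l%:R * H) * M1 ->
  w * M1 = - (H * G1 - H^`() * G) + l%:R * w * H * G /\
  H * G * w ^+ 2 * M2 = w ^+ 2 * M1 ^+ 2 +
    G ^+ 2 * (H * H^`()^`() - H^`() ^+ 2) + H ^+ 2 * (G * G2 - G1 ^+ 2) +
    2 * H * G * M1 - 2 * l%:R * H ^+ 2 * G ^+ 2.
Proof.
move=> w G G1 G2 Ha H1a H2a g0 E1 E2.
have dw : w^`() = -1 by rewrite /w derivB derivC derivX sub0r.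
have wa : w.[a] = 0 by rewrite /w !hornerE subrr.
have [dG dG1 dG2] : [/\ G^`() = 0, G1^`() = 0 & G2^`() = 0].
  by rewrite /G /G1 /G2 !derivC.
have [Ga G1a G2a] : [/\ G.[a] = g, G1.[a] = g1 & G2.[a] = g2].
  by rewrite /G /G1 /G2 !hornerC.
clearbody w G G1 G2.
have HN (n : nat) : (n%:R : {poly B}).[a] = n%:R by rewrite -polyC_natr hornerC.
pose hE := (HN, hornerD, hornerN, hornerM, wa, Ha, H1a, H2a, Ga, G1a, G2a).
have dN (n : nat) : (n%:R : {poly B})^`() = 0 by rewrite -polyC_natr derivC.
have Ha0 : H.[a] != 0 by rewrite Ha.
split.
  apply/eqP; rewrite -subr_eq0; apply/eqP; apply: (logderiv_uniq Ha0).
    rewrite !hE; ring.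
  rewrite !(dN, derivD, derivN, derivM) dw dG dG1.
  apply/eqP; rewrite -subr_eq0; apply/eqP.
  transitivity (w * (H * M1^`() - H^`() * M1) - H * M1 -
    G * (H * H^`()^`() - H^`() ^+ 2 - l%:R * H ^+ 2)); first by ring.
  by rewrite E1 subrr.
have D1 := congr1 deriv E1.
rewrite !(dN, derivD, derivN, derivM, expr2) dw dG in D1.
apply/eqP; rewrite -subr_eq0; apply/eqP.
apply: (@logderiv_uniq (H ^+ 2) _ a); first by rewrite horner_exp expf_neq0.
  (* The value of M1 on the diagonal, read off from E1 since w vanishes there. *)
  have M1a : M1.[a] = g1 ^+ 2 + l%:R * g ^+ 2 - g * g2.
    have := congr1 (horner^~ a) E1.
    rewrite /= !expr2 !hE => E; apply: (mulfI g0).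
    have -> : g * M1.[a] = - (0 * (g * (M1^`()).[a] - g1 * M1.[a]) - g * M1.[a]) by ring.
    rewrite E; ring.
  by rewrite !expr2 !hE M1a; ring.
rewrite !expr2 !(dN, derivD, derivN, derivM) dw dG dG1 dG2.
apply/eqP; rewrite -subr_eq0; apply/eqP.
set h := H in E1 E2 D1 *; set h1 := h^`() in E1 E2 D1 *.
set h2 := h1^`() in E1 E2 D1 *; set h3 := h2^`() in D1 *.
set m := M1 in E1 E2 D1 *; set m1 := m^`() in E1 E2 D1 *.
set m2 := m1^`() in E1 E2 D1 *; set n1 := M2^`() in E2 *.
(* H Z' - 2 H' Z as a combination of E2, E1 and the derivative of E1. *)
transitivity (h * (h * G * w * ((w * (h * n1 - h1 * M2) - 2 * h * M2) -
   (h * m2 - 2 * h1 * m1 + (h2 - 2 * l%:R * h) * m))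
 - 2 * w * m * ((w * (h * m1 - h1 * m) - h * m) -
    G * (h * h2 - h1 ^+ 2 - l%:R * h ^+ 2))
 + G * (h * ((-1 * (h * m1 - h1 * m) + w * (h1 * m1 + h * m2 - (h2 * m + h1 * m1))
  - (h1 * m + h * m1)) - G * (h1 * h2 + h * h3 - 2 * h1 * h2 - 2 * l%:R * h * h1))
 - 2 * h1 * ((w * (h * m1 - h1 * m) - h * m) -
    G * (h * h2 - h1 ^+ 2 - l%:R * h ^+ 2))))).
  ring.
rewrite E1 E2.
have -> : - 1 * (h * m1 - h1 * m) + w * (h1 * m1 + h * m2 - (h2 * m + h1 * m1))
  - (h1 * m + h * m1) = G * (h1 * h2 + h * h3 - 2 * h1 * h2 - 2 * l%:R * h * h1).
  rewrite D1; ring.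
rewrite !subrr; ring.
Qed.
End LogDeriv.

(** * The exceptional series and the value of the quotient at 1 *)

Lemma zseries_sumE (A : comNzRingType) (I : Type) (r : seq I) (P : pred I)
    (F : I -> zseries A) n :
  (\sum_(i <- r | P i) F i) n = \sum_(i <- r | P i) F i n.
Proof. exact: (big_morph (fun s : zseries A => s n)). Qed.

Section ExceptionalSeries.
Variables (K : numFieldType) (k : seq nat).
Hypothesis uk : uniq k.

Let fs := [seq herm K j | j <- k].
Let l := size k.
Let H := wronskian fs.
Let Wh n := wronskian (rcons fs (herm K n)).
Local Notation A := {poly {poly K}}.

(** Polynomials in two variables: the outer one is x, the inner one is y. *)
Definition xhalf : {rmorphism {poly K} -> A} := map_poly polyC.
Definition yhalf : {rmorphism {poly K} -> A} := @polyC {poly K}.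
Definition Dx : {additive A -> A} := @deriv {poly K}.
Definition Dy : {additive A -> A} := map_poly (@deriv K).

Lemma DxM a b : Dx (a * b) = Dx a * b + a * Dx b. Proof. exact: derivM. Qed.
Lemma DyM a b : Dy (a * b) = Dy a * b + a * Dy b.
Proof. by apply: map_derivM; exact: derivM. Qed.
Lemma Dx_x p : Dx (xhalf p) = xhalf p^`(). Proof. exact: deriv_map. Qed.
Lemma Dx_y p : Dx (yhalf p) = 0. Proof. exact: derivC. Qed.
Lemma Dy_y p : Dy (yhalf p) = yhalf p^`(). Proof. exact: map_polyC. Qed.
Lemma Dy_x p : Dy (xhalf p) = 0.
Proof.
by apply/polyP => i; rewrite /Dy /xhalf /= !coef_map /= derivC coef0.
Qed.
Lemma half_C c : xhalf c%:P = yhalf c%:P. Proof. exact: map_polyC. Qed.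

Definition exceptional_weight (n : nat) : K :=
  (2 ^+ (n + size k) * n`!%:R * \prod_(j <- k) (n%:R - j%:R))^-1.

Definition exceptional_series : zseries A := fun n =>
  if n \in k then 0 else yhalf (exceptional_weight n)%:P * (xhalf (Wh n) * yhalf (Wh n)).

Let E : zseries A := mehler_series xhalf yhalf.

Lemma herm_wronskian_neq0 : H != 0.
Proof.
apply: wronskian_neq0.
  apply/negP => /mapP[j _ /esym/eqP].
  by rewrite -size_poly_eq0 size_herm.
rewrite -map_comp map_inj_uniq // => i j /=.
by rewrite !size_herm => -[].
Qed.

Lemma Wh_mem n : n \in k -> Wh n = 0.
Proof. by move=> nk; apply: wronskian_rcons_mem; apply: map_f. Qed.

(** The factors 2(k_j - n) cancel the denominator of the n-th coefficient; for n
    in k both sides vanish, the Wronskian having a repeated column. *)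
Lemma exceptional_series_prod n : \prod_(j <- k) (2 * (j%:R - n%:R)) * exceptional_series n =
  (-1) ^+ l * (yhalf (mehler_weight K n)%:P * (xhalf (Wh n) * yhalf (Wh n))).
Proof.
rewrite /exceptional_series; case: ifPn => [nk|nk].
  by rewrite (Wh_mem nk) !rmorph0 !(mul0r, mulr0).
rewrite mulrA [RHS]mulrA; congr (_ * _).
have -> : \prod_(j <- k) (2 * (j%:R - n%:R)) =
    yhalf (\prod_(j <- k) (2 * (j%:R - n%:R)))%:P :> A.
  rewrite !rmorph_prod; apply: eq_bigr => j _.
  by rewrite !(rmorphM, rmorphB, rmorph_nat).
have -> : (-1) ^+ l = yhalf ((-1) ^+ l)%:P :> A by rewrite !rmorphXn !rmorphN1.
rewrite -!rmorphM /=; congr (yhalf _%:P).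
have -> : \prod_(j <- k) (2 * (j%:R - n%:R)) =
    (-1) ^+ l * 2 ^+ l * \prod_(j <- k) (n%:R - j%:R) :> K.
  rewrite /l; elim: (k) => [|j r IHr]; first by rewrite !big_nil !expr0 !mulr1.
  by rewrite !big_cons IHr /= !exprS; ring.
rewrite /exceptional_weight /mehler_weight exprD -/l.
have n0 : (n`!%:R : K) != 0 by rewrite pnatr_eq0 gtn_eqF ?fact_gt0.
have p0 : \prod_(j <- k) (n%:R - j%:R) != 0 :> K.
  rewrite prodf_seq_neq0; apply/allP => j jk; rewrite subr_eq0 eqr_nat.
  by apply: contraNneq nk => ->.
by field; rewrite n0 p0 !expf_neq0 ?pnatr_eq0.
Qed.

Let Sx : zseries A :=
  \sum_(i < l.+1) (xhalf (wcoef fs i))%:P *: iter i (zder Dx) E.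

Lemma SxE n : Sx n =
  yhalf (mehler_weight K n)%:P * (xhalf (Wh n) * yhalf (herm K n)).
Proof.
rewrite /Sx zseries_sumE /Wh wronskian_rcons size_map rmorph_sum mulr_suml mulr_sumr.
apply: eq_bigr => i _; rewrite zscaleC (zder_iter_mehler_series DxM Dx_x Dx_y).
by move: (wcoef fs i) => c; rewrite rmorphM half_C; ring.
Qed.

Lemma diffop_mehler_series :
  \sum_(j < l.+1) (yhalf (wcoef fs j))%:P *: iter j (zder Dy) Sx =
  fun n => yhalf (mehler_weight K n)%:P * (xhalf (Wh n) * yhalf (Wh n)).
Proof.
have it j n : iter j (zder Dy) Sx n =
    yhalf (mehler_weight K n)%:P * (xhalf (Wh n) * yhalf (herm K n)^`(j)).
  elim: j => [|j IHj]; first by rewrite /= SxE.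
  rewrite iterS /zder IHj !DyM !Dy_y Dy_x derivC rmorph0.
  by rewrite !mul0r !add0r -derivnS.
apply/funext => n; rewrite zseries_sumE.
have -> : yhalf (Wh n) = \sum_(j < l.+1) yhalf (wcoef fs j) * yhalf (herm K n)^`(j).
  rewrite /Wh wronskian_rcons size_map rmorph_sum.
  by apply: eq_bigr => j _; exact: rmorphM.
rewrite !mulr_sumr; apply: eq_bigr => j _; rewrite zscaleC it; ring.
Qed.

Lemma mul_XsubY_neq0 : yhalf 'X - xhalf 'X != 0 :> A.
Proof.
rewrite -opprB oppr_eq0 /xhalf /yhalf /= map_polyX.
by rewrite polyXsubC_eq0.
Qed.

(** Up to the sign (-1)^l, the product of the operators -2 z d/dz + 2 k_j
    applied to q E is W_x W_y E.  At z = 1 the first has leading coefficient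
    (2(y-x))^(2l) q(1), the second (2(y-x))^l (2(x-y))^l H(x) H(y). *)
Theorem exceptional_series_quotient_at1 q : q *: E = exceptional_series -> q.[1] = xhalf H * yhalf H.
Proof.
move=> qE.
have E0 : E 0%N = 1 by exact: mehler_series0.
have num := zsymbol_znum_mehler_series DxM Dx_x Dx_y; rewrite -/E in num.
have := zsymbol_prodnum k num (zsymbol_base E q); rewrite qE.
rewrite (_ : (fun n => _) = ((-1) ^+ l)%:P *: (\sum_(j < l.+1) (yhalf (wcoef fs j))%:P *: iter j (zder Dy) Sx)); last first.
  by apply/funext => n; rewrite zscaleC diffop_mehler_series exceptional_series_prod.
set gx := 'X * (2 * yhalf 'X)%:P - 'X^2 * (2 * xhalf 'X)%:P.
set gy := 'X * (2 * xhalf 'X)%:P - 'X^2 * (2 * yhalf 'X)%:P.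
have dEx : (1 - 'X^2) *: zder Dx E = gx *: E by exact: (mehler_series_der DxM Dx_x Dx_y).
have dEy : (1 - 'X^2) *: zder Dy E = gy *: E.
  have -> : E = mehler_series yhalf xhalf.
    by apply/funext => n; rewrite /E /mehler_series half_C [_ * yhalf (herm K n)]mulrC.
  exact: (mehler_series_der DyM Dy_y Dy_x).
have b1 := zsymbol_base E 1; rewrite scale1r hornerC in b1.
have sx := zsymbol_diffop DxM dEx (fun i => xhalf (wcoef fs i)) l b1.
have sxy := zsymbol_diffop DyM dEy (fun i => yhalf (wcoef fs i)) l sx.
have {sx sxy} := zsymbolZ (((-1) ^+ l)%:P) sxy.
rewrite !add0n addnn => s1 s2; have := zsymbol_uniq E0 s2 s1.
have -> : gx.[1] = 2 * (yhalf 'X - xhalf 'X).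
  by rewrite /gx hornerD hornerN !(hornerM, hornerX, hornerC); ring.
have -> : gy.[1] = - (2 * (yhalf 'X - xhalf 'X)).
  by rewrite /gy hornerD hornerN !(hornerM, hornerX, hornerC); ring.
have -> : wcoef fs l = H by rewrite /l -(size_map (herm K)) wcoef_size.
rewrite hornerC [(- (2 * _)) ^+ l]exprNn mulr1 -exprM mul2n -addnn exprD.
set t := (2 * _) ^+ l => Et.
have t0 : t * t != 0.
  by rewrite mulf_neq0 // expf_neq0 // mulf_neq0 ?mul_XsubY_neq0 // -[2]polyC_natr polyC_eq0 -[2]polyC_natr polyC_eq0 pnatr_eq0.
apply: (mulfI t0); rewrite Et.
have e1 : ((-1) ^+ l * (-1) ^+ l = 1 :> A) by rewrite -expr2 sqrr_sign.
transitivity ((-1) ^+ l * (-1) ^+ l * (t * t * (xhalf H * yhalf H))); first by ring.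
by rewrite e1 mul1r.
Qed.

End ExceptionalSeries.

(** * Derivatives of the quotient at 1 *)

Lemma deriv_map_additive (A : comNzRingType) (D : {additive A -> A})
    (p : {poly A}) : (map_poly D p)^`() = map_poly D p^`().
Proof. by apply/polyP => i; rewrite coef_deriv !coef_map coef_deriv raddfMn. Qed.

Lemma horner1_map_additive (A : comNzRingType) (D : {additive A -> A})
    (p : {poly A}) : (map_poly D p).[1] = D p.[1].
Proof.
rewrite (@horner_coef_wide _ (size p)) ?size_poly // horner_coef raddf_sum.
by apply: eq_bigr => i _; rewrite coef_map expr1n !mulr1.
Qed.

(** First and second z-derivatives at z = 1; the highest derivatives of V are
    killed by 1-z^2. *)
Lemma singular_equation_at1 (A : comNzRingType) (U V : {poly A}) (b c : A) :
  (1 - 'X^2) * V + 2 * U * ('X * b%:P - 'X^2 * c%:P) = 0 ->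
  2 * (U^`().[1] * (b - c) + U.[1] * (b - 2 * c)) - 2 * V.[1] = 0 /\
  2 * (U^`()^`().[1] * (b - c) + 2 * U^`().[1] * (b - 2 * c)
    - 2 * c * U.[1]) - 2 * V.[1] - 4 * V^`().[1] = 0.
Proof.
move=> F0.
have d1 : (1 : {poly A})^`() = 0 by rewrite -polyC1 derivC.
have dn (n : nat) : (n%:R : {poly A})^`() = 0 by rewrite -polyC_natr derivC.
have hn (n : nat) : (n%:R : {poly A}).[1] = n%:R by rewrite -polyC_natr hornerC.
pose d := (dn, d1, deriv0, derivC, derivX, derivM, derivD, derivN).
pose e := (hn, horner0, hornerC, hornerX, hornerM, hornerD, hornerN).
have F1 := congr1 deriv F0; rewrite !expr2 !d in F1.
have F2 := congr1 deriv F1; rewrite !d in F2.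
have := congr1 (horner^~ 1) F1; have := congr1 (horner^~ 1) F2.
rewrite /= !e => E2 E1.
by split; [rewrite -[RHS]E1 | rewrite -[RHS]E2]; ring.
Qed.

(** The equation for q obtained by dividing the evolution equation by E, and its
    first and second z-derivatives at z = 1.  There the factor 1-z^2 vanishes, so
    the equation loses one order of z-derivative, and the value of the first
    order operator h D - h1 on q(1) is zero by the last hypothesis. *)
Lemma transport_moments (A : idomainType) (D : {additive A -> A})
    (q : {poly A}) (x y h h1 c1 c0 : A) :
    (2 != 0 :> A) ->
    let dq := map_poly D q in let ddq := map_poly D dq in
    c1 = 2 * (x * h + h1) ->
    (1 - 'X^2) * (h%:P * ddq - c1%:P * dq + c0%:P * q + 2 * h%:P * 'X * q^`()) +
    2 * (h%:P * dq - h1%:P * q) * ('X * (2 * y)%:P - 'X^2 * (2 * x)%:P) = 0 ->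
    h * D q.[1] = h1 * q.[1] ->
  let M1 := q^`().[1] in let M2 := q^`()^`().[1] + M1 in
  2 * (y - x) * (h * D M1 - h1 * M1) =
    h * D (D q.[1]) - c1 * D q.[1] + c0 * q.[1] + 2 * h * M1 /\
  (y - x) * (h * D M2 - h1 * M2) - 2 * h * M2 =
    h * D (D M1) - 2 * h1 * D M1 + (c0 - 2 * x * h1) * M1.
Proof.
move=> two dq ddq c1E /singular_equation_at1[].
have dn (n : nat) : (n%:R : {poly A})^`() = 0 by rewrite -polyC_natr derivC.
have hn (n : nat) : (n%:R : {poly A}).[1] = n%:R by rewrite -polyC_natr hornerC.
rewrite !(dn, deriv_map_additive, derivD, derivN, derivM, derivX, derivC).
rewrite !(hn, horner1_map_additive, horner0, hornerC, hornerX, hornerD, hornerN, hornerM).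
set q0 := q.[1]; set q1 := q^`().[1]; set q2 := q^`()^`().[1].
move=> F1 F2 tr0 /=.
rewrite raddfD /=; set dq2 := D q2 in F2 *.
set dq1 := D q1 in F1 F2 *; set ddq1 := D dq1 in F1 F2 *.
set dq0 := D q0 in tr0 F1 F2 *; set ddq0 := D dq0 in F1 F2 *.
have G1 : 2 * (y - x) * (h * dq1 - h1 * q1) =
    h * ddq0 - c1 * dq0 + c0 * q0 + 2 * h * q1.
  apply: (mulfI two); apply/eqP; rewrite -subr_eq0; apply/eqP.
  by rewrite -[RHS]F1 tr0; ring.
split=> //; apply: (mulfI (mulf_neq0 two two)).
apply/eqP; rewrite -subr_eq0; apply/eqP; rewrite -[RHS]F2 tr0.
apply/eqP; rewrite -subr_eq0; apply/eqP.
transitivity (2 * ((h * ddq0 - c1 * dq0 + c0 * q0 + 2 * h * q1) -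
  2 * (y - x) * (h * dq1 - h1 * q1))); last by rewrite -G1 subrr mulr0.
by rewrite c1E; ring.
Qed.

Local Notation px := (xhalf _).

Lemma eigen_xhalf (K : numFieldType) (h W : {poly K}) (l n : nat) :
  px (h * W^`()^`() - 2 * ('X * h + h^`()) * W^`() +
     (h^`()^`() + 2 * 'X * h^`() - (2 * l)%:R * h) * W) =
    px (h * (- (2 * n)%:R *: W)) ->
  px h * px W^`()^`() - 2 * (px 'X * px h + px h^`()) * px W^`() +
     (px h^`()^`() + 2 * px 'X * px h^`() - (2 * l)%:R * px h) * px W =
    px h * (px W * - (2 * n)%:R).
Proof.
rewrite -mul_polyC polyCN.
have nat m : px (m%:R : {poly K}) = m%:R by rewrite rmorph_nat.
have natC m : px (m%:R%:P : {poly K}) = m%:R by rewrite rmorph_polyC_nat.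
move: h^`() W^`() h^`()^`() W^`()^`() => h1 W1 h2 W2.
rewrite !(natC, nat, rmorphD, rmorphN, rmorphM) => ->; ring.
Qed.

Section ExceptionalMoments.
Variables (K : numFieldType) (k : seq nat).
Hypothesis uk : uniq k.

Let fs := [seq herm K j | j <- k].
Let l := size k.
Let H := wronskian fs.
Local Notation A := {poly {poly K}}.
Local Notation px := (xhalf K).
Local Notation py := (yhalf K).

Let E : zseries A := mehler_series px py.
Let x : A := px 'X.
Let y : A := py 'X.
Let c1 : A := 2 * (x * px H + px H^`()).
Let c0 : A := px H^`()^`() + 2 * x * px H^`() - (2 * l)%:R * px H.

(** The Darboux-Crum relation, coefficient by coefficient. *)
Lemma exceptional_series_eigen :
  (px H)%:P *: zder (@Dx K) (zder (@Dx K) (exceptional_series K k)) +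
  (- c1)%:P *: zder (@Dx K) (exceptional_series K k) + c0%:P *: exceptional_series K k =
  (px H)%:P *: znum (exceptional_series K k).
Proof.
apply/funext => n; rewrite !zseriesDE !zscaleC /zder /znum /exceptional_series.
case: ifP => _; first by rewrite !raddf0 mul0r !mulr0 !addr0.
have D1 p : @Dx K (py (exceptional_weight K k n)%:P * (px p *
      py (wronskian (rcons fs (herm K n))))) =
    py (exceptional_weight K k n)%:P * (px p^`() *
      py (wronskian (rcons fs (herm K n)))).
  by rewrite !DxM !Dx_y Dx_x mul0r add0r mulr0 addr0.
rewrite !D1; have := crum_intertwining (fs := fs) _ (herm_wronskian_neq0 K uk) (herm K n).
have eig f : f \in fs -> exists a, f^`()^`() - 2 *: ('X * f^`()) = a *: f.
  by case/mapP => j _ ->; exists (- (2 * j)%:R); rewrite herm_ode.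
rewrite -/H size_map -/l herm_ode wronskian_rconsZ => /(_ eig).
set W := wronskian (rcons fs _) => /(congr1 px)/eigen_xhalf.
rewrite -/x -/c1 -/c0 => E1.
set v := py (exceptional_weight _ _ _)%:P; set u := py W.
transitivity (v * u * (px H * px W^`()^`() - c1 * px W^`() + c0 * px W)).
  by ring.
by rewrite E1; ring.
Qed.

Theorem exceptional_series_moments q : q *: E = exceptional_series K k ->
  let M1 := q^`().[1] in let M2 := q^`()^`().[1] + M1 in
  let w : A := 'X%:P - 'X in
  let h := px H in let h1 := px H^`() in let h2 := px H^`()^`() in
  let g := py H in let g1 := py H^`() in let g2 := py H^`()^`() in
  [/\ q.[1] = h * g,
      w * M1 = - (h * g1 - h1 * g) + l%:R * w * h * g &
      h * g * w ^+ 2 * M2 = w ^+ 2 * M1 ^+ 2 +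
        g ^+ 2 * (h * h2 - h1 ^+ 2) + h ^+ 2 * (g * g2 - g1 ^+ 2) +
        2 * h * g * M1 - 2 * l%:R * h ^+ 2 * g ^+ 2].
Proof.
move=> qE M1 M2 w h h1 h2 g g1 g2.
have M0 : q.[1] = h * g by exact: exceptional_series_quotient_at1.
have E0 : E 0%N = 1 by exact: mehler_series0.
pose D := @Dx K; pose E1 := zder D E; pose E2 := zder D E1.
(* All terms are combinations of E, E_x and E_xx. *)
pose lc a b c := a *: E + b *: E1 + c *: E2.
have lcD a b c a' b' c' : lc a b c + lc a' b' c' = lc (a + a') (b + b') (c + c').
  by rewrite /lc !scalerDl; rewrite addrACA; congr (_ + _); rewrite addrACA.
have lcZ p a b c : p *: lc a b c = lc (p * a) (p * b) (p * c).
  by rewrite /lc !scalerDr !scalerA.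
pose dq := map_poly D q; pose ddq := map_poly D dq.
have e0 : exceptional_series K k = lc q 0 0 by rewrite /lc !scale0r !addr0 qE.
have e1 : zder D (exceptional_series K k) = lc dq q 0.
  by rewrite -qE zderM ?/lc ?scale0r ?addr0 //; exact: DxM.
have e2 : zder D (zder D (exceptional_series K k)) = lc ddq (2 * dq) q.
  rewrite -qE zderM; last exact: DxM.
  rewrite zderD !zderM; try exact: DxM.
  rewrite /lc -/dq -/ddq -/E1 -/E2 mulr2n mulrDl mul1r scalerDl.
  by rewrite !addrA.
have en : znum (exceptional_series K k) = lc (- 2 * ('X * q^`())) (- (q * (2 * x)%:P)) q.
  rewrite -qE znumM -(mehler_series_num (@DxM K) (@Dx_x K) (@Dx_y K)).
  by rewrite -/E -/E1 -/E2 /lc scalerBr scalerA scaleNr -addrA [X in _ + X]addrC addrA.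
have := exceptional_series_eigen; rewrite -/D e2 e1 en e0 !lcZ !lcD => /eqP.
rewrite -subr_eq0.
have -> (u v : zseries A) : u - v = u + (- 1) *: v by rewrite scaleN1r.
rewrite lcZ lcD => /eqP.
set a := (X in lc X _ _); set b := (X in lc _ X _); set c := (X in lc _ _ X).
(* The E_xx terms cancel, since -2z E_z also contains E_xx. *)
have c0E : c = 0 by rewrite /c; ring.
move=> lc0.
have dE : (1 - 'X^2) *: E1 = ('X * (2 * y)%:P - 'X^2 * (2 * x)%:P) *: E.
  exact: (mehler_series_der (@DxM K) (@Dx_x K) (@Dx_y K)).
have tr : (1 - 'X^2) * a + b * ('X * (2 * y)%:P - 'X^2 * (2 * x)%:P) = 0.
  apply: (zscale_eq0 E0); rewrite scalerDl -!scalerA -dE.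
  have := congr1 (fun s : zseries A => (1 - 'X^2) *: s) lc0.
  rewrite /lc c0E scale0r addr0 scaler0 scalerDr !scalerA => <-.
  by rewrite [b * _]mulrC.
have two : 2 != 0 :> A by rewrite -[2]polyC_natr polyC_eq0 -[2]polyC_natr polyC_eq0 pnatr_eq0.
have P2 : (2 : A)%:P = 2 by exact: (rmorph_nat polyC 2).
have tr' : (1 - 'X^2) * (h%:P * ddq - c1%:P * dq + c0%:P * q +
      2 * h%:P * 'X * q^`()) +
    2 * (h%:P * dq - h1%:P * q) * ('X * (2 * y)%:P - 'X^2 * (2 * x)%:P) = 0.
  rewrite -[RHS]tr /a /b -/h /c1 -/h -/h1 polyCN !polyCM !polyCD !polyCM P2.
  ring.
have Dh : D h = h1 by exact: Dx_x.
have Dh1 : D h1 = h2 by exact: Dx_x.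
have Dg : D g = 0 by exact: Dx_y.
have DM0 : D q.[1] = h1 * g by rewrite M0 DxM -/D Dh Dg mulr0 addr0.
have DDM0 : D (D q.[1]) = h2 * g by rewrite DM0 DxM -/D Dh1 Dg mulr0 addr0.
have tr0 : h * D q.[1] = h1 * q.[1] by rewrite DM0 M0; ring.
have [T1 T2] := @transport_moments A D q x y h h1 c1 c0 two erefl tr' tr0.
have yx : y - x = w by rewrite /y /x /w /xhalf /yhalf /= map_polyX.
have at_diag p : (px p).['X] = p by exact: comp_polyXr.
have inj : forall n, n.+1%:R != 0 :> {poly K}.
  by move=> n; rewrite -polyC_natr polyC_eq0 pnatr_eq0.
have dh : h^`() = h1 by exact: Dh.
have dh1 : h1^`() = h2 by exact: Dh1.
have hH : h.['X] = H by exact: at_diag.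
have h1H : h^`().['X] = H^`() by rewrite dh; exact: at_diag.
have h2H : h^`()^`().['X] = H^`()^`() by rewrite dh dh1; exact: at_diag.
have H0 : H != 0 by exact: herm_wronskian_neq0.
have := @moment_identities {poly K} inj l 'X h M1 M2 H H^`() H^`()^`()
  hH h1H h2H H0.
rewrite dh dh1 => ids; have [||I1 I2] := ids _ _; last by split.
  apply: (mulfI two).
  transitivity (2 * (y - x) * (h * D M1 - h1 * M1) - 2 * h * M1).
    by rewrite yx -/w /D /Dx /=; ring.
  rewrite T1 DDM0 DM0 M0 /c1 /c0 -/h -/h1 -/h2 -/(py H) -/g -/M1 natrM; ring.
transitivity ((y - x) * (h * D M2 - h1 * M2) - 2 * h * M2).
  by rewrite yx -/w /D /Dx /=; ring.
rewrite T2 -/M1 /c0 -/h -/h1 -/h2 natrM /D /Dx /=; ring.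
Qed.

End ExceptionalMoments.

(** * The Rodrigues formula *)

Lemma poly_eq0_nat (K : idomainType) (p : {poly K}) :
  (forall n, n.+1%:R != 0 :> K) -> (forall n : nat, p.[n%:R] = 0) -> p = 0.
Proof.
move=> char0 p0; apply/eqP; apply/negPn/negP => np.
have := @max_poly_roots _ p [seq n%:R | n <- iota 0 (size p)] np.
rewrite size_map size_iota ltnn => H; have //: false; apply: H.
  by apply/allP => _ /mapP[n _ ->]; apply/rootP.
rewrite map_inj_uniq ?iota_uniq // => i j.
wlog ij : i j / (i <= j)%N => [hw|/esym/eqP].
  by have [/hw//|/ltnW/hw h /esym/h] := leqP i j.
rewrite -subr_eq0 -natrB //; case E : (j - i)%N => [|d].
  by move=> _; apply/eqP; rewrite eqn_leq ij -subn_eq0 E.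
by rewrite (negPf (char0 d)).
Qed.

Lemma map_herm (K L : comNzRingType) (f : {rmorphism K -> L}) n :
  map_poly f (herm K n) = herm L n.
Proof.
elim: n => [|n IHn]; first by rewrite rmorph1.
rewrite !hermS -!mul_polyC rmorphB !rmorphM /= map_polyX map_polyC /= -deriv_map.
by rewrite IHn rmorph_nat.
Qed.

Lemma rodrigues_herm (R : realType) n (x : R) : rodrigues n x = (herm R n).[x].
Proof.
suff hE m : derive1n m (fun t : R => expR (- t ^+ 2)) =
    (fun t => (-1) ^+ m * (herm R m).[t] * expR (- t ^+ 2)).
  rewrite /rodrigues hE; transitivity ((-1) ^+ n * (-1) ^+ n * (herm R n).[x] *
    (expR (x ^+ 2) * expR (- x ^+ 2))); first by ring.
  by rewrite -expr2 sqrr_sign -expRD subrr expR0 mul1r mulr1.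
elim: m => [|m IHm]; first by apply/funext => t; rewrite /= hornerC !mul1r.
rewrite derive1nS IHm; apply/funext => t.
have dp := is_derive_poly ((-1) ^+ m *: herm R m) t.
have dq : is_derive t (1 : R) (fun u : R => - u ^+ 2) (- (2 * t)).
  have := is_derive_poly (- 'X^2) t.
  rewrite (_ : horner _ = (fun u : R => - u ^+ 2)); last first.
    by apply/funext => u; rewrite !hornerE.
  by rewrite derivN derivXn !hornerE mulr_natl.
have de : is_derive t (1 : R) (fun u : R => expR (- u ^+ 2))
    (expR (- t ^+ 2) * - (2 * t)).
  exact: (@is_derive1_comp _ expR (fun u : R => - u ^+ 2)).
rewrite (_ : (fun _ => _) =
    horner ((-1) ^+ m *: herm R m) * (fun u : R => expR (- u ^+ 2))); last first.
  apply/funext => u; transitivity (((-1) ^+ m *: herm R m).[u] * expR (- u ^+ 2)).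
    by rewrite hornerZ.
  by [].
rewrite derive1E (@derive_val _ _ _ _ _ _ _ (is_deriveM dp de)).
rewrite derivZ hermS !hornerE /GRing.scale /= [(-1) ^+ m.+1]exprS; ring.
Qed.

Lemma hermiteC_herm (R : realType) n : hermiteC R n = herm (C R) n.
Proof.
rewrite /hermiteC -(map_herm (real_complex R)); congr map_poly.
apply/eqP; rewrite -subr_eq0; apply/eqP/poly_eq0_nat => [j|j]; first by rewrite pnatr_eq0.
by rewrite hornerD hornerN hermiteP rodrigues_herm subrr.
Qed.

(** * Growth of Hermite polynomials *)

Section Growth.
Variable K : numFieldType.
Implicit Types u v : nat -> K.

Lemma sqr_normD_le (a b : K) : `|a + b| ^+ 2 <= 2 * (`|a| ^+ 2 + `|b| ^+ 2).
Proof.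
apply: (@le_trans _ _ ((`|a| + `|b|) ^+ 2)).
  by rewrite lerXn2r ?nnegrE ?addr_ge0 ?ler_normD.
rewrite -subr_ge0 (_ : _ - _ = (`|a| - `|b|) ^+ 2); last by ring.
by rewrite real_exprn_even_ge0 // rpredB // normr_real.
Qed.

(** The growth of H_n(x); a product of two such sequences divided by 2^n n! is
    geometrically bounded.  Squares avoid the square root of n!. *)
Definition mehler_bounded u := exists M B : K,
  [/\ 0 <= M, 1 <= B &
      forall n, `|u n| ^+ 2 <= M * (2 ^+ n * n`!%:R * B ^+ n)].

Definition geom_bounded u := exists M B : K,
  [/\ 0 <= M, 1 <= B & forall n, `|u n| <= M * B ^+ n].

Lemma weight_ge0 n : 0 <= 2 ^+ n * n`!%:R :> K.
Proof. by rewrite mulr_ge0 ?exprn_ge0 ?ler0n. Qed.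

Lemma bound_le (M1 M2 B1 B2 c : K) n : 0 <= M1 <= M2 -> 1 <= B1 <= B2 -> 0 <= c ->
  M1 * (c * B1 ^+ n) <= M2 * (c * B2 ^+ n).
Proof.
move=> /andP[M10 M12] /andP[B11 B12] c0.
have B0 : 0 <= B1 by exact: le_trans ler01 B11.
apply: ler_pM => //; first by rewrite mulr_ge0 // exprn_ge0.
by rewrite ler_wpM2l // lerXn2r // nnegrE (le_trans B0).
Qed.

Lemma ge1_mul (B1 B2 : K) : 1 <= B1 -> 1 <= B2 ->
  [/\ 1 <= B1 * B2, B1 <= B1 * B2 & B2 <= B1 * B2].
Proof.
move=> h1 h2; have p1 := le_trans ler01 h1; have p2 := le_trans ler01 h2.
by split; [exact: mulr_ege1 | rewrite ler_peMr | rewrite ler_peMl].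
Qed.

Lemma mehler_boundedD u v : mehler_bounded u -> mehler_bounded v ->
  mehler_bounded (fun n => u n + v n).
Proof.
move=> [M1 [B1 [M10 B11 h1]]] [M2 [B2 [M20 B21 h2]]].
have [B12 le1 le2] := ge1_mul B11 B21.
exists (2 * (M1 + M2)), (B1 * B2); split => //.
  by rewrite mulr_ge0 ?ler0n // addr_ge0.
move=> n; apply: (le_trans (sqr_normD_le _ _)).
rewrite -mulrA ler_wpM2l ?ler0n // mulrDl lerD //.
  by apply: (le_trans (h1 n)); rewrite bound_le ?weight_ge0 // ?M10 ?lexx ?B11.
by apply: (le_trans (h2 n)); rewrite bound_le ?weight_ge0 // ?M20 ?lexx ?B21.
Qed.

Lemma mehler_boundedZ (c : K) u :
  mehler_bounded u -> mehler_bounded (fun n => c * u n).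
Proof.
move=> [M [B [M0 B1 h]]]; exists (`|c| ^+ 2 * M), B; split => //.
  by rewrite mulr_ge0 // exprn_ge0.
by move=> n; rewrite normrM exprMn -[leRHS]mulrA ler_wpM2l // exprn_ge0.
Qed.

Lemma mehler_bounded0 : mehler_bounded (fun=> 0).
Proof.
by exists 0, 1; split => // n; rewrite normr0 expr0n /= mul0r.
Qed.

(** The shape of the derivation rule H_n' = 2n H_(n-1). *)
Lemma mehler_bounded_shift u : mehler_bounded u ->
  mehler_bounded (fun n => if n is m.+1 then (2 * m.+1)%:R * u m else 0).
Proof.
move=> [M [B [M0 B1 h]]]; have B0 := le_trans ler01 B1.
exists (2 * M), (2 * B); split.
- by rewrite mulr_ge0 ?ler0n.
- by rewrite (le_trans B1) // ler_peMl // ler1n.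
move=> [|m].
  by rewrite normr0 expr0n /= !(mulr_ge0, exprn_ge0, ler0n).
rewrite normrM exprMn normr_nat.
have nle : m.+1%:R <= 2 ^+ m.+1 :> K by rewrite -natrX ler_nat ltnW // ltn_expl.
apply: (le_trans (ler_wpM2l _ (h m))); first by rewrite exprn_ge0 ?ler0n.
rewrite factS !natrM [2 ^+ m.+1]exprS [(2 * B) ^+ _]exprMn [B ^+ m.+1]exprS.
set W := 2 ^+ m * m`!%:R * B ^+ m.
have W0 : 0 <= W by rewrite /W mulr_ge0 ?weight_ge0 // exprn_ge0.
rewrite [leLHS](_ : _ = 4 * m.+1%:R * M * W * m.+1%:R); last by ring.
rewrite [leRHS](_ : _ = 4 * m.+1%:R * M * W * (2 ^+ m.+1 * B)); last first.
  by rewrite /W; ring.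
apply: ler_wpM2l; first by rewrite !(W0, M0, ler0n, mulr_ge0).
by rewrite (le_trans nle) // ler_peMr // exprn_ge0 ?ler0n.
Qed.

(** By the three-term recurrence; B is chosen so that 4|x|^2 <= B and 2 <= B. *)
Lemma mehler_bounded_herm (x : K) : mehler_bounded (fun n => (herm K n).[x]).
Proof.
pose B : K := 2 + 4 * `|x| ^+ 2.
have x0 : 0 <= `|x| ^+ 2 by rewrite exprn_ge0.
have B2 : 2 <= B by rewrite lerDl mulr_ge0 ?ler0n.
have B0 : 0 <= B by rewrite (le_trans _ B2) ?ler0n.
exists 1, B; split => //; first by rewrite (le_trans _ B2) ?ler1n.
suff H n : `|(herm K n).[x]| ^+ 2 <= 2 ^+ n * n`!%:R * B ^+ n /\
    `|(herm K n.+1).[x]| ^+ 2 <= 2 ^+ n.+1 * n.+1`!%:R * B ^+ n.+1.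
  by move=> n; rewrite mul1r; case: (H n).
elim: n => [|n [IH1 IH2]]; split => //.
- by rewrite /= hornerC normr1 expr1n !expr0 !mulr1.
- have -> : (herm K 1).[x] = 2 * x.
    by rewrite hermS /= -polyC1 derivC subr0 mulr1 hornerZ hornerX.
  rewrite normrM normr_nat exprMn !expr1 mulr1.
  rewrite [leLHS](_ : _ = 4 * `|x| ^+ 2); last by ring.
  rewrite (_ : _ * B = 4 + (4 * `|x| ^+ 2) * 2); last by rewrite /B; ring.
  rewrite -[X in X <= _]add0r lerD ?ler0n //.
  by rewrite ler_peMr ?ler1n ?mulr_ge0 ?ler0n.
- have -> : (herm K n.+2).[x] = 2 * x * (herm K n.+1).[x] - 2 * n.+1%:R * (herm K n).[x].
    by rewrite hermS deriv_herm hornerD hornerN !hornerZ hornerM hornerX natrM; ring.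
  apply: (le_trans (sqr_normD_le _ _)).
  rewrite normrN !normrM !normr_nat !exprMn.
  set a := `|(herm K n.+1).[x]| ^+ 2 in IH2 *.
  set b := `|(herm K n).[x]| ^+ 2 in IH1 *.
  rewrite !factS !natrM [2 ^+ n.+2]exprS [2 ^+ n.+1]exprS.
  rewrite [B ^+ n.+2]exprS [B ^+ n.+1]exprS.
  rewrite !factS !natrM [2 ^+ n.+1]exprS [B ^+ n.+1]exprS in IH2.
  set W := 2 ^+ n * n`!%:R * B ^+ n in IH1.
  have W0 : 0 <= W by rewrite mulr_ge0 ?weight_ge0 // exprn_ge0.
  have {}IH2 : a <= 2 * n.+1%:R * B * W.
    by apply: (le_trans IH2); rewrite /W le_eqVlt; apply/orP; left; apply/eqP; ring.
  rewrite [leRHS](_ : _ = (2 * 2 * n.+1%:R * W) * (n.+2%:R * (B * B))); last first.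
    by rewrite /W; ring.
  have n0 : 0 <= n.+1%:R :> K by rewrite ler0n.
  apply: (@le_trans _ _ (2 * (2 ^+ 2 * `|x| ^+ 2 * (2 * n.+1%:R * B * W) +
      2 ^+ 2 * n.+1%:R ^+ 2 * W))).
    apply: ler_wpM2l; first by rewrite ler0n.
    by apply: lerD; apply: ler_wpM2l => //; rewrite mulr_ge0 // exprn_ge0 ?ler0n.
  rewrite [leLHS](_ : _ = (2 * 2 * n.+1%:R * W) * (4 * `|x| ^+ 2 * B + n.+1%:R * 2)); last by ring.
  apply: ler_wpM2l; first by rewrite !(W0, ler0n, mulr_ge0).
  rewrite -[n.+2%:R]natr1 [leRHS]mulrDl mul1r [leLHS]addrC; apply: lerD.
    apply: ler_wpM2l => //; apply: (le_trans B2).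
    by apply: ler_peMr => //; apply: (le_trans _ B2); rewrite ler1n.
  by apply: ler_wpM2r => //; rewrite /B lerDr ler0n.
Qed.

Lemma mehler_bounded_derivn (x : K) i :
  mehler_bounded (fun n => (herm K n)^`(i).[x]).
Proof.
elim: i => [|i IHi]; first exact: mehler_bounded_herm.
rewrite (_ : (fun n => _) = (fun n => if n is m.+1 then
   (2 * m.+1)%:R * (herm K m)^`(i).[x] else 0)); first exact: mehler_bounded_shift.
apply/funext => -[|m].
  by rewrite derivSn /= -polyC1 derivC linear0 horner0.
by rewrite derivSn deriv_herm derivnZ hornerZ.
Qed.

Lemma mehler_bounded_wronskian (fs : seq {poly K}) (x : K) :
  mehler_bounded (fun n => (wronskian (rcons fs (herm K n))).[x]).
Proof.
rewrite (_ : (fun n => _) = (fun n => \sum_(i < (size fs).+1)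
    (wcoef fs i).[x] * (herm K n)^`(i).[x])); last first.
  apply/funext => n; rewrite wronskian_rcons horner_sum.
  by apply: eq_bigr => i _; rewrite hornerM.
elim: (_.+1) => [|m IHm].
  rewrite (_ : (fun n => _) = (fun=> 0)); first exact: mehler_bounded0.
  by apply/funext => n; rewrite big_ord0.
rewrite (_ : (fun n => _) = (fun n => (\sum_(i < m)
    (wcoef fs i).[x] * (herm K n)^`(i).[x]) +
    (wcoef fs m).[x] * (herm K n)^`(m).[x])); last first.
  by apply/funext => n; rewrite big_ord_recr.
apply: mehler_boundedD => //; apply: mehler_boundedZ.
exact: mehler_bounded_derivn.
Qed.

Lemma geom_bounded_weight u v (w : nat -> K) :
  mehler_bounded u -> mehler_bounded v ->
  (forall n, `|w n| <= mehler_weight K n) ->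
  geom_bounded (fun n => w n * (u n * v n)).
Proof.
move=> [M1 [B1 [M10 B11 h1]]] [M2 [B2 [M20 B21 h2]]] hw.
have [B12 le1 le2] := ge1_mul B11 B21.
exists (M1 + M2), (B1 * B2); split; rewrite ?addr_ge0 // => n.
have W0 : 0 < 2 ^+ n * n`!%:R :> K.
  by rewrite mulr_gt0 ?exprn_gt0 ?ltr0n ?fact_gt0.
rewrite normrM; apply: (le_trans (ler_wpM2r (normr_ge0 _) (hw n))).
rewrite /mehler_weight mulrC ler_pdivrMr // normrM.
apply: (@le_trans _ _ (`|u n| ^+ 2 + `|v n| ^+ 2)).
  rewrite -subr_ge0 (_ : _ - _ = (`|u n| - `|v n|) ^+ 2 + `|u n| * `|v n|); last by ring.
  apply: addr_ge0; last exact: mulr_ge0.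
  by rewrite real_exprn_even_ge0 // rpredB // normr_real.
rewrite -[leRHS]mulrA [leRHS]mulrDl; apply: lerD; rewrite [_ ^+ n * _]mulrC.
  by apply: (le_trans (h1 n)); rewrite bound_le ?weight_ge0 // ?M10 ?lexx ?B11.
by apply: (le_trans (h2 n)); rewrite bound_le ?weight_ge0 // ?M20 ?lexx ?B21.
Qed.

Lemma geom_boundedD u v : geom_bounded u -> geom_bounded v ->
  geom_bounded (fun n => u n + v n).
Proof.
move=> [M1 [B1 [M10 B11 h1]]] [M2 [B2 [M20 B21 h2]]].
have [B12 le1 le2] := ge1_mul B11 B21.
exists (M1 + M2), (B1 * B2); split; rewrite ?addr_ge0 // => n.
have p1 := le_trans ler01 B11; have p2 := le_trans ler01 B21.
rewrite (le_trans (ler_normD _ _)) // mulrDl lerD //.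
  by rewrite (le_trans (h1 n)) // ler_wpM2l // lerXn2r // nnegrE mulr_ge0.
by rewrite (le_trans (h2 n)) // ler_wpM2l // lerXn2r // nnegrE mulr_ge0.
Qed.

Lemma geom_boundedZ (c : K) u : geom_bounded u -> geom_bounded (fun n => c * u n).
Proof.
move=> [M [B [M0 B1 h]]]; exists (`|c| * M), B; split; rewrite ?mulr_ge0 // => n.
by rewrite normrM -mulrA ler_wpM2l.
Qed.

Lemma geom_bounded_shift u : geom_bounded u ->
  geom_bounded (fun n => if n is m.+1 then u m else 0).
Proof.
move=> [M [B [M0 B1 h]]]; have B0 := le_trans ler01 B1.
exists M, B; split => // -[|m]; first by rewrite normr0 mulr_ge0.
by rewrite (le_trans (h m)) // ler_wpM2l // exprS ler_peMl // exprn_ge0.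
Qed.

Lemma geom_bounded_zscale (q : {poly K}) (s : zseries K) :
  geom_bounded s -> geom_bounded (q *: s).
Proof.
move=> hs; elim/poly_ind: q => [|p c IHp].
  by rewrite scale0r; exists 0, 1; split => // n; rewrite normr0 mul0r.
have [e1 e2] : ('X *: (p *: s) = (fun n => if n is m.+1 then (p *: s) m else 0)
    :> (nat -> K)) /\ (c%:P *: s = (fun n => c * s n) :> (nat -> K)).
  by split; apply/funext => n; rewrite ?zscaleX ?zscaleC.
rewrite mulrC scalerDl -scalerA.
apply: (@geom_boundedD ('X *: (p *: s)) (c%:P *: s)).
  by rewrite e1; exact: geom_bounded_shift.
by rewrite e2; exact: geom_boundedZ.
Qed.

End Growth.

(** * Uniqueness and convergence of power series *)

Definition psum (K : numFieldType) (s : nat -> K) (z : K) (N : nat) : K :=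
  \sum_(0 <= n < N) z ^+ n * s n.

Section PowerSeries.
Variable K : numFieldType.
Implicit Types s : zseries K.

Lemma psum_zscale (q : {poly K}) s (z S : K) :
  psum s z @ \oo --> S -> psum (q *: s) z @ \oo --> q.[z] * S.
Proof.
move=> hs; elim/poly_ind: q => [|p c IHp].
  rewrite scale0r horner0 mul0r (_ : psum _ z = fun=> 0); first exact: cvg_cst.
  by apply/funext => N; rewrite /psum big1 // => n _; rewrite mulr0.
rewrite mulrC scalerDl -scalerA hornerD hornerC hornerM hornerX mulrDl.
rewrite (_ : psum _ z = psum ('X *: (p *: s)) z \+ psum (c%:P *: s) z); last first.
  apply/funext => N; rewrite /psum /= -big_split /=.
  by apply: eq_bigr => n _; rewrite zseriesDE mulrDr.
apply: cvgD.
  rewrite -cvg_shiftS (_ : [sequence _]_n = fun N => z * psum (p *: s) z N).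
    by rewrite -mulrA; exact: cvgMl_tmp.
  apply/funext => N; rewrite /= /psum big_nat_recl // zscaleX mulr0 add0r mulr_sumr.
  by apply: eq_bigr => n _; rewrite zscaleX exprS mulrA.
rewrite (_ : psum _ z = fun N => c * psum s z N); first exact: cvgMl_tmp.
apply/funext => N; rewrite /psum mulr_sumr.
by apply: eq_bigr => n _; rewrite zscaleC mulrCA.
Qed.

Lemma geom_sum_le2 (t : K) N : 0 <= t -> 2 * t <= 1 -> \sum_(0 <= n < N) t ^+ n <= 2.
Proof.
move=> t0 t1; suff : \sum_(0 <= n < N) t ^+ n <= 2 - 2 * t ^+ N.
  by move/le_trans; apply; rewrite lerBlDr lerDl mulr_ge0 ?exprn_ge0.
elim: N => [|N IHN]; first by rewrite big_geq // expr0 mulr1 subrr.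
rewrite big_nat_recr //= (le_trans (lerD IHN (lexx _))) //.
rewrite exprS -subr_ge0 (_ : _ - _ = t ^+ N * (1 - 2 * t)); last by ring.
by rewrite mulr_ge0 ?exprn_ge0 // subr_ge0.
Qed.

(** At the first nonzero coefficient s_n, the tail of the series is at most
    2 M (B t)^(n+1), negligible against |s_n| t^n for small t. *)
Lemma psum_uniq s (r : K) : geom_bounded s -> 0 < r ->
  (forall z, `|z| <= r -> psum s z @ \oo --> 0) -> forall n, s n = 0.
Proof.
move=> [M [B [M0 B1 h]]] r0 hz n.
have [m] := ubnP n; elim: m n => // m IHm n nm.
apply/eqP/negPn/negP => sn0.
have B0 : 0 < B by exact: lt_le_trans ltr01 B1.
have key (t : K) : 0 < t -> t <= r -> 2 * (B * t) <= 1 ->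
    `|s n| <= t * (2 * M * B ^+ n.+1).
  move=> t0 tr tB; rewrite -(ler_pM2l (exprn_gt0 n t0)).
  apply/ler_addgt0Pr => e e0.
  have /hz/cvgr0_norm_lt/(_ e e0)[N0 _ hN] : `|t| <= r by rewrite gtr0_norm.
  have /hN /= := leq_maxl N0 n.+1; set N := maxn N0 n.+1 => ltN.
  have nN : (n.+1 <= N)%N by exact: leq_maxr.
  have split_sum : psum s t N = t ^+ n * s n + \sum_(n.+1 <= i < N) t ^+ i * s i.
    rewrite /psum (big_cat_nat _ nN) //=; congr (_ + _).
    rewrite big_nat_recr //= big1_seq ?add0r // => i.
    rewrite mem_index_iota => /andP[_ iN].
    by rewrite IHm ?mulr0 // (leq_trans iN).
  have tail : `|\sum_(n.+1 <= i < N) t ^+ i * s i| <= t ^+ n * (t * (2 * M * B ^+ n.+1)).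
    apply: (le_trans (ler_norm_sum _ _ _)).
    apply: (@le_trans _ _ (\sum_(n.+1 <= i < N) M * (B * t) ^+ i)).
      apply: ler_sum => i _; rewrite normrM normrX gtr0_norm // mulrC exprMn mulrA.
      by rewrite ler_wpM2r // exprn_ge0 // ltW.
    rewrite -{1}(add0n n.+1) big_addn -mulr_sumr.
    under eq_bigr do rewrite exprD.
    rewrite -mulr_suml.
    have g2 := geom_sum_le2 (N - n.+1) (ltW (mulr_gt0 B0 t0)) tB.
    apply: (@le_trans _ _ (M * (2 * (B * t) ^+ n.+1))).
      by rewrite ler_wpM2l // ler_wpM2r // exprn_ge0 // mulr_ge0 // ltW.
    by rewrite le_eqVlt; apply/orP; left; apply/eqP; rewrite exprMn [t ^+ n.+1]exprS; ring.
  have -> : t ^+ n * `|s n| = `|psum s t N - \sum_(n.+1 <= i < N) t ^+ i * s i|.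
    by rewrite split_sum addrK normrM normrX gtr0_norm.
  apply: (le_trans (ler_normB _ _)); rewrite addrC lerD // ltW //.
(* A small enough t without minima, which a mere numeric field does not have. *)
pose d := r^-1 + 2 * B + 2 * M * B ^+ n.+1 / `|s n|.
have sn : 0 < `|s n| by rewrite normr_gt0.
have q0 : 0 <= 2 * M * B ^+ n.+1 / `|s n|.
  by rewrite divr_ge0 // mulr_ge0 ?mulr_ge0 ?ler0n // exprn_ge0 // ltW.
have B2 : 0 <= 2 * B by rewrite mulr_ge0 ?ler0n // ltW.
have ri : 0 < r^-1 by rewrite invr_gt0.
have d0 : 0 < d by rewrite /d -addrA ltr_wpDr // addr_ge0.
have := key d^-1; rewrite invr_gt0 d0 => /(_ isT).
have -> : d^-1 <= r.
  by rewrite -[r]invrK lef_pV2 ?posrE // /d -addrA lerDl addr_ge0.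
have -> : 2 * (B * d^-1) <= 1.
  rewrite mulrA ler_pdivrMr // mul1r /d addrAC lerDr addr_ge0 // ltW //.
move=> /(_ isT isT) hle.
suff /lt_le_trans/(_ hle) : d^-1 * (2 * M * B ^+ n.+1) < `|s n| by rewrite ltxx.
rewrite [ltLHS]mulrC ltr_pdivrMr // [ltRHS]mulrC -ltr_pdivrMr // /d ltrDr.
by rewrite ltr_wpDr.
Qed.
End PowerSeries.

Section ComplexConvergence.
Variable R : realType.

Lemma cvg_real_complex (u : nat -> R) : cvgn u ->
  cvgn (fun n => (u n)%:C%C : C R).
Proof.
move=> /cvg_ex[l ul]; apply/cvg_ex; exists (l%:C%C : C R).
apply/cvgrPdist_lt => e e0.
have eR : e = (complex.Re e)%:C%C by rewrite RRe_real // gtr0_real.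
have e0' : 0 < complex.Re e by move: e0; rewrite eR ltcR.
move/cvgrPdist_lt : ul => /(_ _ e0'); apply: filterS => n.
by rewrite -rmorphB normc_def /= expr0n addr0 sqrtr_sqr eR ltcR.
Qed.

(** Absolute convergence, through the completeness of the reals applied to the
    real and imaginary parts. *)
Lemma cvg_complex_series (u : nat -> C R) (M : R) :
  (forall n, `|u n| <= (M * 2^-1 ^+ n)%:C%C) ->
  cvgn (fun N => \sum_(0 <= n < N) u n).
Proof.
move=> hu.
have cvgR (w : nat -> R) : (forall n, `|w n| <= M * 2^-1 ^+ n) ->
    cvgn (fun N => \sum_(0 <= n < N) w n).
  move=> hw; have : cvgn (series w); last by [].
  apply: normed_cvg; apply: (@series_le_cvg _ _ (geometric M 2^-1)) => //.
  - by move=> n; exact: normr_ge0.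
  - by move=> n; exact: le_trans (normr_ge0 _) (hw n).
  - apply: is_cvg_geometric_series; rewrite ger0_norm ?invr_ge0 //.
    by rewrite invf_lt1 // ltr1n.
have reB n : `|complex.Re (u n)| <= M * 2^-1 ^+ n.
  by have := le_trans (normc_ge_Re (u n)) (hu n); rewrite lecR.
have imB n : `|complex.Im (u n)| <= M * 2^-1 ^+ n.
  have h1 : `|(u n : R[i]) * 'i%C| <= (M * 2^-1 ^+ n)%:C%C.
    rewrite normrM (_ : `|'i%C| = 1) ?mulr1 //.
    by rewrite normc_def /= expr0n expr1n add0r sqrtr1.
  by have := le_trans (normc_ge_Re _) h1; rewrite ReiNIm normrN lecR.
have c1 := cvg_real_complex (cvgR _ reB).
have c2 := cvg_real_complex (cvgR _ imB).
rewrite (_ : (fun N => _) = (fun N => (\sum_(0 <= n < N) complex.Re (u n))%:C%C : C R) \+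
    (fun N => ('i%C : C R) * ((\sum_(0 <= n < N) complex.Im (u n))%:C%C : C R))).
  case/cvg_ex: c1 => l1 c1; case/cvg_ex: c2 => l2 c2.
  apply/cvg_ex; exists (l1 + ('i%C : C R) * l2); apply: cvgD c1 _.
  exact: cvgMl_tmp.
apply/funext => N /=; rewrite !rmorph_sum mulr_sumr -big_split /=.
by apply: eq_bigr => n _; rewrite [LHS]complexE.
Qed.

Lemma psum_cvg (s : nat -> C R) : geom_bounded s ->
  exists2 r : C R, 0 < r & forall z, `|z| <= r -> cvgn (psum s z).
Proof.
move=> [M [B [M0 B1 h]]]; have B0 : 0 < B by exact: lt_le_trans ltr01 B1.
exists (2 * B)^-1; first by rewrite invr_gt0 mulr_gt0.
move=> z zr; apply: (@cvg_complex_series _ (complex.Re M)) => n.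
have MR : M = (complex.Re M)%:C%C by rewrite RRe_real // ger0_real.
rewrite rmorphM rmorphXn fmorphV /= -MR rmorph_nat normrM normrX mulrC.
apply: (le_trans (ler_wpM2r _ (h n))); first by rewrite exprn_ge0.
rewrite -mulrA ler_wpM2l // -exprMn lerXn2r ?nnegrE ?mulr_ge0 ?invr_ge0 ?(ltW B0) //.
apply: (le_trans (ler_wpM2l (ltW B0) zr)).
by rewrite invfM mulrCA mulfV ?mulr1 // gt_eqF.
Qed.
End ComplexConvergence.

(** * From convergent to formal series *)

Lemma eval2_xhalf (K : numFieldType) (p : {poly K}) (x y : K) :
  (xhalf K p).[x, y] = p.[x].
Proof. by rewrite /xhalf /= horner_map /= hornerC. Qed.

Lemma eval2_yhalf (K : numFieldType) (p : {poly K}) (x y : K) :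
  (yhalf K p).[x, y] = p.[y].
Proof. by rewrite /yhalf /= hornerC. Qed.

Lemma eval2M (K : comNzRingType) (p q : {poly {poly K}}) (x y : K) :
  (p * q).[x, y] = p.[x, y] * q.[x, y].
Proof. by rewrite !hornerM. Qed.

Lemma poly2_eq0 (K : numFieldType) (p : {poly {poly K}}) :
  (forall x y : K, p.[x, y] = 0) -> p = 0.
Proof.
move=> p0; apply: poly_eq0_nat => n.
  by rewrite -polyC_natr polyC_eq0 pnatr_eq0.
apply: poly_eq0_nat => [i|i]; first by rewrite pnatr_eq0.
by rewrite -polyC_natr p0.
Qed.

Section SeriesIdentity.
Variables (R : realType) (k : seq nat).
Local Notation K := (C R).
Let fs := [seq herm K j | j <- k].
Let Wh n := wronskian (rcons fs (herm K n)).

Lemma hermiteW_herm : hermiteW R k = wronskian fs.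
Proof. by rewrite /hermiteW; congr wronskian; apply: eq_map => j; rewrite hermiteC_herm. Qed.

Lemma hermiteWn_herm n : hermiteWn R k n = Wh n.
Proof.
rewrite /hermiteWn /Wh hermiteC_herm; congr (wronskian (rcons _ _)).
by apply: eq_map => j; rewrite hermiteC_herm.
Qed.

Let mcoef (x y : K) : zseries K :=
  fun n => mehler_weight K n * ((herm K n).[x] * (herm K n).[y]).
Let wcoefs (x y : K) : zseries K := fun n =>
  (if n \in k then 0 else exceptional_weight K k n) * ((Wh n).[x] * (Wh n).[y]).

Lemma mehlerE z x y : mehler z x y = limn (psum (mcoef x y) z).
Proof.
rewrite /mehler (_ : psum _ z = fun N => \sum_(0 <= n < N) z ^+ n *
  ((hermiteC R n).[x] * (hermiteC R n).[y] / (2 ^+ n * n`!%:R))) //.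
apply/funext => N; apply: eq_bigr => n _.
by rewrite !hermiteC_herm /mcoef /mehler_weight; congr (_ * _); rewrite mulrC.
Qed.

Lemma mehlerWE z x y : mehlerW k z x y = limn (psum (wcoefs x y) z).
Proof.
rewrite /mehlerW (_ : psum _ z = fun N => \sum_(0 <= n < N | n \notin k) z ^+ n *
  ((hermiteWn R k n).[x] * (hermiteWn R k n).[y] /
    (2 ^+ (n + size k) * n`!%:R * \prod_(j <- k) (n%:R - j%:R)))) //.
apply/funext => N; rewrite /psum [RHS]big_mkcond /=.
apply: eq_bigr => n _; rewrite /wcoefs; case: ifP => nk /=.
  by rewrite mul0r mulr0.
by rewrite !hermiteWn_herm /exceptional_weight; congr (_ * _); rewrite mulrC.
Qed.

Lemma geom_bounded_mcoef x y : geom_bounded (mcoef x y).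
Proof.
apply: (@geom_bounded_weight _ (fun n => (herm K n).[x])
  (fun n => (herm K n).[y]) (mehler_weight K)) => [||n];
  try exact: mehler_bounded_herm.
by rewrite ger0_norm // /mehler_weight invr_ge0 weight_ge0.
Qed.

Lemma geom_bounded_wcoefs x y : geom_bounded (wcoefs x y).
Proof.
apply: (@geom_bounded_weight _ (fun n => (Wh n).[x]) (fun n => (Wh n).[y])
  (fun n => if n \in k then 0 else exceptional_weight K k n)) => [||n];
  try exact: mehler_bounded_wronskian.
have w0 : 0 <= mehler_weight K n by rewrite invr_ge0 weight_ge0.
case: ifPn => nk; first by rewrite normr0.
have W0 : 0 < 2 ^+ n * n`!%:R :> K.
  by rewrite mulr_gt0 ?exprn_gt0 ?ltr0n ?fact_gt0.
have P1 : 1 <= `|\prod_(j <- k) (n%:R - j%:R : K)|.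
  elim: (k) nk => [|j r IHr]; first by rewrite big_nil normr1.
  rewrite inE negb_or big_cons normrM => /andP[nj /IHr{}IHr].
  apply: mulr_ege1 => //.
  wlog ij : n j nj {W0 w0 IHr} / (j < n)%N.
    move=> hw; case: (ltngtP j n) (nj) => [jn _|nlj _|_ //].
      exact: hw.
    by rewrite distrC; apply: hw => //; rewrite eq_sym.
  by rewrite -natrB ?(ltnW ij) // normr_nat ler1n subn_gt0.
rewrite /exceptional_weight /mehler_weight normfV lef_pV2 ?posrE //; last first.
  by rewrite !normrM !mulr_gt0 // ?(lt_le_trans ltr01 P1) // ?normr_gt0 ?expf_neq0 ?pnatr_eq0 // gtn_eqF ?fact_gt0.
rewrite normrM -[leLHS]mulr1; apply: ler_pM => //.
rewrite normrM exprD normrM ger0_norm ?exprn_ge0 // normr_nat.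
rewrite ler_wpM2r ?ler0n // ler_peMr ?exprn_ge0 //.
by rewrite normrX normr_nat exprn_ege1 // ler1n.
Qed.

(** For fixed x and y both sides of the hypothesis are sums of convergent power
    series for small z, so their coefficients agree; a polynomial in two
    variables that vanishes everywhere is zero. *)
Theorem quotient_series (Q : nat -> {poly {poly K}}) (m : nat) :
    (forall z x y : K, `|z| < 1 -> mehlerW k z x y =
       mehler z x y * \sum_(0 <= n < m) z ^+ n * (Q n).[x, y]) ->
  \poly_(n < m) Q n *: mehler_series (xhalf K) (yhalf K) =
  exceptional_series K k.
Proof.
move=> hQ; apply/funext => n; apply/eqP; rewrite -subr_eq0; apply/eqP.
apply: poly2_eq0 => x y.
pose qe := \poly_(n < m) (Q n).[x, y].
have eE i : (mehler_series (xhalf K) (yhalf K) i).[x, y] = mcoef x y i.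
  by rewrite /mehler_series !hornerM !eval2_xhalf eval2_yhalf hornerC.
have eX i : (exceptional_series K k i).[x, y] = wcoefs x y i.
  rewrite /exceptional_series /wcoefs; case: ifP; first by rewrite mul0r !horner0.
  by rewrite !hornerM !eval2_yhalf eval2_xhalf hornerC.
rewrite hornerD hornerN hornerD hornerN eX.
have -> : ((\poly_(n < m) Q n *: mehler_series (xhalf K) (yhalf K)) n).[x, y] =
    (qe *: mcoef x y) n.
  rewrite !zscaleE !horner_sum; apply: eq_bigr => j _.
  by rewrite eval2M eE !coef_poly; case: ifP; rewrite ?horner0.
pose s : zseries K := qe *: mcoef x y - wcoefs x y.
suff : s n = 0 by [].
have [r1 r10 h1] := psum_cvg (geom_bounded_mcoef x y).
have [r2 r20 h2] := psum_cvg (geom_bounded_wcoefs x y).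
(* A radius below r1, r2 and 1, which need not be comparable. *)
pose r := (r1^-1 + r2^-1 + 2)^-1.
have ri1 : 0 < r1^-1 by rewrite invr_gt0.
have ri2 : 0 < r2^-1 by rewrite invr_gt0.
have rr1 : r <= r1.
  by rewrite /r -[leRHS]invrK lef_pV2 ?posrE ?addr_gt0 // -addrA lerDl addr_ge0 // ltW.
have rr2 : r <= r2.
  by rewrite /r -[leRHS]invrK lef_pV2 ?posrE ?addr_gt0 // addrAC lerDr addr_ge0 // ltW.
have r_lt1 : r < 1.
  rewrite /r -[ltRHS]invr1 ltf_pV2 ?posrE ?addr_gt0 //.
  by apply: (@lt_le_trans _ _ 2); [rewrite ltr1n|rewrite lerDr addr_ge0 // ltW].
apply: (@psum_uniq _ s r).
- rewrite /s -scaleN1r -polyC1 -polyCN.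
  have -> : qe *: mcoef x y + (-1)%:P *: wcoefs x y = fun n => (qe *: mcoef x y) n + (-1) * wcoefs x y n.
    by apply/funext => i; rewrite zseriesDE zscaleC.
  apply: geom_boundedD; first exact: geom_bounded_zscale (geom_bounded_mcoef x y).
  exact: geom_boundedZ (geom_bounded_wcoefs x y).
- by rewrite /r invr_gt0 !addr_gt0.
move=> z zr.
have c1 := h1 z (le_trans zr rr1); have c2 := h2 z (le_trans zr rr2).
have := hQ z x y (le_lt_trans zr r_lt1); rewrite mehlerE mehlerWE => E.
have -> : psum s z = psum (qe *: mcoef x y) z \+ (fun N => - psum (wcoefs x y) z N).
  apply/funext => N; rewrite /psum /= -sumrN -big_split /=.
  by apply: eq_bigr => i _; rewrite -mulrBr.
rewrite -(subrr (limn (psum (wcoefs x y) z))).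
apply: cvgD; last by apply: cvgN.
have {}E : limn (psum (wcoefs x y) z) = qe.[z] * limn (psum (mcoef x y) z).
  rewrite E mulrC; congr (_ * _); rewrite big_mkord /qe horner_poly.
  by apply: eq_bigr => i _; rewrite mulrC.
by rewrite E; exact: (@psum_zscale _ qe _ _ _ c1).
Qed.
End SeriesIdentity.

(** * Continuity, density and limits *)

Section PolynomialTopology.
Variable K : numFieldType.

Lemma cvg_horner (T : Type) (F : set_system T) (FF : Filter F) (f : T -> K)
    (a : K) (p : {poly K}) :
  f @ F --> a -> p.[f t] @[t --> F] --> p.[a].
Proof.
move=> fa; elim/poly_ind: p => [|p c IHp].
  rewrite horner0 (_ : (fun t => _) = fun=> 0); first exact: cvg_cst.
  by apply/funext => t; rewrite horner0.
rewrite hornerMXaddC.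
rewrite (_ : (fun t => _) = (fun t => p.[f t] * f t) \+ fun=> c); last first.
  by apply/funext => t; rewrite hornerMXaddC.
by apply: cvgD; [exact: cvgM|exact: cvg_cst].
Qed.

Lemma cvg_horner2 (T : Type) (F : set_system T) (FF : Filter F) (f g : T -> K)
    (a b : K) (p : {poly {poly K}}) :
  f @ F --> a -> g @ F --> b -> p.[f t, g t] @[t --> F] --> p.[a, b].
Proof.
move=> fa gb; elim/poly_ind: p => [|p c IHp].
  rewrite !horner0 (_ : (fun t => _) = fun=> 0); first exact: cvg_cst.
  by apply/funext => t; rewrite !horner0.
rewrite hornerMXaddC hornerD hornerM hornerC.
rewrite (_ : (fun t => _) = (fun t => p.[f t, g t] * f t) \+ fun t => c.[g t]).
  by apply: cvgD; [exact: cvgM|exact: cvg_horner].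
by apply/funext => t; rewrite hornerMXaddC hornerD hornerM hornerC.
Qed.

Lemma horner_continuous (p : {poly K}) : continuous (fun x : K => p.[x]).
Proof. by move=> x; exact: (@cvg_horner K (nbhs x) _ id x p cvg_id). Qed.

Lemma horner2_continuous (p : {poly {poly K}}) :
  continuous (fun u : K * K => p.[u.1, u.2]).
Proof.
by move=> u; exact: (@cvg_horner2 _ (nbhs u) _ fst snd u.1 u.2 p cvg_fst cvg_snd).
Qed.

Lemma horner_near_neq0 (p : {poly K}) (x : K) :
  p.[x] != 0 -> \forall y \near x, p.[y] != 0.
Proof. by move=> px; exact: (cvgr_neq0 _ (@horner_continuous p x) px). Qed.

(** Factor out the zero of p at x. *)
Lemma horner_dnbhs_neq0 (p : {poly K}) (x : K) :
  p != 0 -> \forall y \near x^', p.[y] != 0.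
Proof.
move=> p0; have [m [q]] := multiplicity_XsubC p x; rewrite p0 /= => qx ->.
have := nbhs_dnbhs (horner_near_neq0 qx).
apply: filterS2 (nbhs_dnbhs_neq x) => y yx qy.
by rewrite hornerM horner_exp !hornerE mulf_neq0 // expf_neq0 // subr_eq0.
Qed.

(** Choose the first coordinate off the zeros of p, then the second one off the
    zeros of p and off the first coordinate. *)
Lemma dense_regular (p : {poly K}) : p != 0 ->
  dense [set u : K * K | [/\ u.1 != u.2, p.[u.1] != 0 & p.[u.2] != 0]].
Proof.
move=> p0 O [u Ou] Oo.
have [[A B] [/= Au Bu] AB] := open_nbhs_nbhs (conj Oo Ou).
have [x [Ax px]] : exists x, A x /\ p.[x] != 0.
  apply: (@filter_ex _ (u.1)^' _ (fun x => A x /\ p.[x] != 0)).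
  by apply: filterI; [exact: nbhs_dnbhs|exact: horner_dnbhs_neq0].
have pX : p * ('X - x%:P) != 0 by rewrite mulf_neq0 // polyXsubC_eq0.
have [y [By]] : exists y, B y /\ (p * ('X - x%:P)).[y] != 0.
  apply: (@filter_ex _ (u.2)^' _ (fun y => B y /\ (p * ('X - x%:P)).[y] != 0)).
  by apply: filterI; [exact: nbhs_dnbhs|exact: horner_dnbhs_neq0].
rewrite hornerM !hornerE mulf_eq0 negb_or subr_eq0 => /andP[py yx].
exists (x, y); split; last by split => //=; rewrite eq_sym.
exact: AB.
Qed.

(** The numerator p(x) p'(y) - p'(x) p(y) is divisible by y-x, and the value at x
    of the quotient is its derivative. *)
Lemma logderiv_quotient_cvg (p : {poly K}) (x : K) : p.[x] != 0 ->
  (y - x)^-1 * (p^`().[y] / p.[y] - p^`().[x] / p.[x]) @[y --> x^'] -->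
  (p^`()^`().[x] / p.[x] - p^`().[x] ^+ 2 / p.[x] ^+ 2).
Proof.
move=> px; pose N := p.[x] *: p^`() - p^`().[x] *: p.
have /factor_theorem[q Nq] : root N x.
  by apply/rootP; rewrite /N !hornerE mulrC subrr.
have qx : q.[x] = p.[x] * p^`()^`().[x] - p^`().[x] ^+ 2.
  have := congr1 (fun r => r^`().[x]) Nq.
  by rewrite derivM derivXsubC /N derivB !derivZ !hornerE subrr mulr0 add0r.
have -> : p^`()^`().[x] / p.[x] - p^`().[x] ^+ 2 / p.[x] ^+ 2 =
    q.[x] * (p.[x] * p.[x])^-1.
  by rewrite qx; field.
apply: (@cvg_trans _ (q.[y] * (p.[x] * p.[y])^-1 @[y --> x^'])).
  apply: near_eq_cvg.
  have hy := nbhs_dnbhs (horner_near_neq0 px).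
  apply: filterS2 (nbhs_dnbhs_neq x) hy => y yx py.
  have := congr1 (horner^~ y) Nq; rewrite /N !hornerE /= => Ny.
  have yx0 : y - x != 0 by rewrite subr_eq0.
  apply: (mulIf (mulf_neq0 (mulf_neq0 px py) yx0)).
  transitivity (q.[y] * (y - x)); first by field; rewrite px py.
  by rewrite -Ny; field; rewrite px py.
apply: cvg_within_filter; apply: cvgM; first exact: horner_continuous.
apply: cvgV; first by rewrite mulf_neq0.
by apply: cvgM; [exact: cvg_cst|exact: horner_continuous].
Qed.
End PolynomialTopology.

Lemma poly_moments (A : comNzRingType) (m : nat) (Q : nat -> A) :
  let q := \poly_(n < m) Q n in
  [/\ q.[1] = \sum_(0 <= n < m) Q n,
      q^`().[1] = \sum_(0 <= n < m) n%:R * Q n &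
      q^`()^`().[1] + q^`().[1] = \sum_(0 <= n < m) n%:R ^+ 2 * Q n].
Proof.
move=> q; rewrite !big_mkord /q poly_def; split.
- rewrite horner_sum; apply: eq_bigr => i _.
  by rewrite hornerZ hornerXn expr1n mulr1.
- rewrite raddf_sum /= horner_sum; apply: eq_bigr => i _.
  by rewrite derivZ derivXn hornerZ hornerMn hornerXn expr1n mulrC.
- rewrite !raddf_sum /= !horner_sum -big_split /=; apply: eq_bigr => i _.
  rewrite !derivZ !derivXn derivMn derivXn !hornerZ !hornerMn !hornerXn !expr1n.
  case: (i : nat) => [|j]; first by rewrite mulr0n; ring.
  by rewrite /= -[_ *+ j *+ _]mulr_natr; ring.
Qed.

Lemma eval2D (K : comNzRingType) (p q : {poly {poly K}}) (x y : K) :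
  (p + q).[x, y] = p.[x, y] + q.[x, y].
Proof. by rewrite !hornerD. Qed.

Lemma eval2N (K : comNzRingType) (p : {poly {poly K}}) (x y : K) :
  (- p).[x, y] = - p.[x, y].
Proof. by rewrite !hornerN. Qed.

Lemma eval2_nat (K : comNzRingType) (n : nat) (x y : K) :
  (n%:R : {poly {poly K}}).[x, y] = n%:R.
Proof. by rewrite -polyC_natr hornerC -polyC_natr hornerC. Qed.

Lemma eval2_sum_moment (K : comNzRingType) (m e : nat)
    (Q : nat -> {poly {poly K}}) (x y : K) :
  (\sum_(0 <= n < m) n%:R ^+ e * Q n).[x, y] =
  \sum_(0 <= n < m) n%:R ^+ e * (Q n).[x, y].
Proof.
rewrite !horner_sum; apply: eq_bigr => n _; rewrite eval2M; congr (_ * _).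
by rewrite -!natrX eval2_nat.
Qed.

(** * The moment identities *)

Theorem proposition2 (R : realType) (k : seq nat)
    (Q : nat -> {poly {poly C R}})
    (hk : krein_adler k)
    (hQ : forall z x y : C R, `|z| < 1 ->
       mehlerW k z x y =
       mehler z x y * \sum_(0 <= n < (last 0%N k).+2) z ^+ n * (Q n).[x, y]) :
  let H := hermiteW R k in
  let l : C R := (size k)%:R in
  [/\ forall x : C R, H.[x] != 0 ->
        Omega k x y @[y --> x^'] -->
          (H^`()^`().[x] / H.[x] - H^`().[x] ^+ 2 / H.[x] ^+ 2 : C R),
      forall x y : C R,
        \sum_(0 <= n < (last 0%N k).+2) (Q n).[x, y] = H.[x] * H.[y],
      continuous_extension (@regular_pairs R k)
        (fun p => - (H.[p.1] * H.[p.2] * (Omega k p.1 p.2 - l)))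
        (fun p => \sum_(0 <= n < (last 0%N k).+2) n%:R * (Q n).[p.1, p.2]) &
      continuous_extension (@regular_pairs R k)
        (fun p => H.[p.1] * H.[p.2] *
           ((Omega k p.1 p.2 - l) ^+ 2 +
            (omega k p.1 + omega k p.2 - 2 * Omega k p.1 p.2) /
              (p.2 - p.1) ^+ 2))
        (fun p => \sum_(0 <= n < (last 0%N k).+2)
           n%:R ^+ 2 * (Q n).[p.1, p.2])].
Proof.
move=> H l.
have uk : uniq k by case: hk => /(sorted_uniq ltn_trans ltnn).
have HE : H = wronskian [seq herm (C R) j | j <- k] by exact: hermiteW_herm.
have H0 : H != 0 by rewrite HE herm_wronskian_neq0.
set m := (last 0%N k).+2 in hQ *.
have [] := exceptional_series_moments uk (quotient_series hQ).
have [-> -> ->] := poly_moments m Q.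
rewrite -HE => I0 I1 I2.
have w_ev (x y : C R) : ('X%:P - 'X).[x, y] = y - x.
  by rewrite eval2D eval2N !hornerX !hornerC hornerX.
have mom1 (x y : C R) : (\sum_(0 <= n < m) n%:R * Q n).[x, y] =
    \sum_(0 <= n < m) n%:R * (Q n).[x, y].
  exact: (eval2_sum_moment m 1).
pose ev := (w_ev, mom1, eval2_sum_moment, eval2_nat, eval2_xhalf, eval2_yhalf,
  eval2M, eval2D, eval2N).
have cvg_Omega (x : C R) : H.[x] != 0 -> Omega k x y @[y --> x^'] -->
    (H^`()^`().[x] / H.[x] - H^`().[x] ^+ 2 / H.[x] ^+ 2 : C R).
  exact: logderiv_quotient_cvg.
have omegaE (x : C R) : H.[x] != 0 ->
    omega k x = H^`()^`().[x] / H.[x] - H^`().[x] ^+ 2 / H.[x] ^+ 2.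
  by move/cvg_Omega/cvg_lim; apply; exact: norm_hausdorff.
have cont (e : nat) :
    continuous (fun p : C R * C R => (\sum_(0 <= n < m) n%:R ^+ e * Q n).[p.1, p.2]).
  exact: horner2_continuous.
split => //.
- move=> x y; have := congr1 (fun p => p.[x, y]) I0.
  by rewrite eval2M eval2_xhalf eval2_yhalf !horner_sum.
- split; [exact: dense_regular| |].
    move=> [x y] /set_mem[/= xy Hx Hy].
    have yx : y - x != 0 by rewrite subr_eq0 eq_sym.
    have := congr1 (fun p => p.[x, y]) I1; rewrite /= !ev => E1.
    by apply: (mulfI yx); rewrite E1 /Omega -/H /l; field; rewrite Hx Hy yx.
  rewrite (_ : (fun p => _) = fun p : C R * C R =>
    (\sum_(0 <= n < m) n%:R * Q n).[p.1, p.2]); first exact: (cont 1).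
  by apply/funext => p; rewrite mom1.
split; [exact: dense_regular| |].
  move=> [x y] /set_mem[/= xy Hx Hy].
  have yx : y - x != 0 by rewrite subr_eq0 eq_sym.
  have := congr1 (fun p => p.[x, y]) I1; rewrite /= !ev => E1.
  have := congr1 (fun p => p.[x, y]) I2; rewrite /= !expr2 !ev => E2.
  have hw : H.[x] * H.[y] * ((y - x) * (y - x)) != 0 by rewrite !mulf_neq0.
  apply: (mulfI hw); rewrite [RHS]E2 !omegaE // /Omega -/H /l.
  have -> : \sum_(0 <= n < m) n%:R * (Q n).[x, y] =
      (- (H.[x] * H^`().[y] - H^`().[x] * H.[y]) +
       (size k)%:R * (y - x) * H.[x] * H.[y]) / (y - x).
    by rewrite -E1 mulrAC mulfV // mul1r.
  by field; rewrite Hx Hy yx.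
rewrite (_ : (fun p => _) = fun p : C R * C R =>
  (\sum_(0 <= n < m) n%:R ^+ 2 * Q n).[p.1, p.2]); first exact: (cont 2).
by apply/funext => p; rewrite eval2_sum_moment.
Qed.
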